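(* Let $c>0$, $c'\in\mathbb{R}$ and let $M=M_N$ be a sequence of positive integers with $\lim_{N\to\infty}(M-cN)=c'$. Let $X_{1,N},\dots,X_{s,N}$ be independent $N\times N$ real Wishart matrices with the same shape, i.e. all obtained using the same $M$. Let $n\ge1$ and $l_1,\dots,l_n\in\{1,\dots,s\}$. Then $$\lim_{N\to\infty}N\Big\{\mathrm{E}\big(\mathrm{tr}(X_{l_1,N}\cdots X_{l_n,N})\big)-\sum_{\substack{\pi\in NC(n)\\ \pi\le\ker(l)}}c^{\#(\pi)}\Big\}=\sum_{\substack{\pi\in NC(n)\\ \pi\le\ker(l)}}c'\,\#(\pi)\,c^{\#(\pi)-1}+\sum_{\substack{\sigma\in S_{NC}^\delta(n,-n)\\ \sigma\le\widetilde{\ker(l)}}}c^{\#(\sigma)/2}.$$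
   Context: A real Wishart matrix is $X_N=\frac1N GG^t$ with $G$ an $N\times M$ matrix of i.i.d. real $\mathcal{N}(0,1)$ entries. $\mathrm{tr}=N^{-1}\mathrm{Tr}$. $NC(n)$ is the set of non-crossing partitions of $[n]=\{1,\dots,n\}$; for a partition $\#(\pi)$ is the number of blocks; for a permutation $\#(\pi)$ is the number of cycles (fixed points included). $\ker(l)$ is the partition of $[n]$ with $r\sim s$ iff $l_r=l_s$. For a partition $\tau$ of $[n]$, $\tilde\tau$ is the partition of $[\pm n]=\{\pm1,\dots,\pm n\}$ with $r\sim_{\tilde\tau}s$ iff $|r|\sim_\tau|s|$. Partitions are ordered by: $\pi\le\tau$ iff every block of $\pi$ is contained in a block of $\tau$; for a permutation $\sigma$, $\sigma\le\tau$ means every cycle of $\sigma$ is contained in a block of $\tau$. Let $S_{\pm n}$ be the symmetric group of $[\pm n]$ (products composed right to left). Let $\delta\in S_{\pm n}$, $\delta(k)=-k$; let $\gamma\in S_{\pm n}$ be the cycle $(1,2,\dots,n)$, acting trivially on negative numbers; put $\tilde\gamma=\gamma\delta\gamma^{-1}\delta=(1,2,\dots,n)(-n,\dots,-2,-1)$. A pairing is a permutation all of whose cycles have length 2. $S_{NC}^\delta(n,-n)$ is the set of $\sigma\in S_{\pm n}$ such that (1) the subgroup $\langle\sigma,\tilde\gamma\rangle$ acts transitively on $[\pm n]$; (2) $\#(\sigma)+\#(\sigma^{-1}\tilde\gamma)=2n$; (3) $\sigma\delta$ is a pairing. *)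

(* Defs.v *)
From HB Require Import structures.
From mathcomp Require Import all_boot all_order all_algebra all_fingroup.

Set Implicit Arguments.
Unset Strict Implicit.
Unset Printing Implicit Defensive.

Section Partitions.
Variable n : nat.

Definition noncrossing (p : {set {set 'I_n}}) : bool :=
  [forall B in p, forall C in p, (B != C) ==>
    [forall a in B, forall b in C, forall a' in B, forall b' in C,
      ~~ [&& a < b, b < a' & a' < b']]].

Definition NC : {set {set {set 'I_n}}} :=
  [set p | partition p [set: 'I_n] & noncrossing p].

Definition ker_part (I : eqType) (l : 'I_n -> I) : {set {set 'I_n}} :=
  preim_partition l [set: 'I_n].

(* [±n]: the pair (k, false) stands for the integer k + 1 and (k, true) for
   -(k + 1), so that the first projection plays the role of |.|. *)
Definition pm_ord : finType := ('I_n * bool)%type.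

Definition tilde (t : {set {set 'I_n}}) : {set {set pm_ord}} :=
  preim_partition (fun r : pm_ord => pblock t r.1) [set: pm_ord].

End Partitions.

(* For a permutation s, refines (porbits s) t says that every cycle of s is
   contained in a block of t. *)
Definition refines (T : finType) (p t : {set {set T}}) : bool :=
  [forall B in p, exists C in t, B \subset C].

Section SignedPermutations.
Local Open Scope group_scope.
Variable n : nat.

Definition delta_fun (r : pm_ord n) : pm_ord n := (r.1, ~~ r.2).

Lemma delta_fun_inj : injective delta_fun.
Proof. by move=> [i a] [j b] [-> /negb_inj ->]. Qed.

Definition delta : {perm pm_ord n} := perm delta_fun_inj.

Definition gamma_fun (r : pm_ord n) : pm_ord n :=
  if r.2 then r else (ordS r.1, false).

Lemma gamma_fun_inj : injective gamma_fun.
Proof.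
move=> [i [|]] [j [|]] // [e]; congr (_, _) => //.
by apply/ordS_inj/val_inj.
Qed.

Definition gamma : {perm pm_ord n} := perm gamma_fun_inj.

(* The product of {perm T} composes from left to right, (s * t) x = t (s x),
   so every product below is the reverse of the corresponding right-to-left
   one. *)
Definition gamma_tilde : {perm pm_ord n} := delta * gamma^-1 * delta * gamma.

Definition is_pairing (s : {perm pm_ord n}) : bool :=
  [forall C in porbits s, #|C| == 2].

Definition SNC_delta : {set {perm pm_ord n}} :=
  [set s | [&& [transitive <<[set s; gamma_tilde]>>, on [set: pm_ord n] | 'P],
               #|porbits s| + #|porbits (gamma_tilde * s^-1)| == (2 * n)%N
             & is_pairing (delta * s)]].

End SignedPermutations.

From mathcomp Require Import all_classical all_reals all_analysis.

Import Order.TTheory GRing.Theory Num.Theory.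
Import numFieldNormedType.Exports.
Local Open Scope classical_set_scope.
Local Open Scope ring_scope.

Definition ntr (R : realType) (N : nat) (A : 'M[R]_N) : R := N%:R^-1 * \tr A.

Section Independence.
Context (d : measure_display) (T : measurableType d) (R : realType).
Variable P : probability T R.

(* F i is the sigma-algebra of the i-th object of the family. *)
Definition independent_family (I : finType) (F : I -> set (set T)) : Prop :=
  forall (J : {set I}) (A : I -> set T), (forall i, i \in J -> F i (A i)) ->
    P (\bigcap_(i in [set i | i \in J]) A i) = (\prod_(i in J) P (A i))%E.

Definition sigma_rv (Y : T -> R) : set (set T) :=
  preimage_set_system [set: T] Y measurable.

Definition sigma_rmx (m n : nat) (Y : T -> 'M[R]_(m, n)) : set (set T) :=
  <<s [set A | exists i j, sigma_rv (fun w => Y w i j) A] >>.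

Definition iid_std_normal (I : finType) (g : I -> {RV P >-> R}) : Prop :=
  independent_family (fun i => sigma_rv (g i)) /\
  forall i (B : set R), measurable B ->
    distribution P (g i) B = normal_prob 0 1 B.

Definition real_wishart (N M : nat) (X : T -> 'M[R]_N) : Prop :=
  exists g : 'I_N * 'I_M -> {RV P >-> R}, iid_std_normal g /\
    forall w, let G : 'M[R]_(N, M) := \matrix_(i, j) g (i, j) w in
      X w = N%:R^-1 *: (G *m G^T).

End Independence.

(* Main.v *)
Require Import Defs.
From HB Require Import structures.
From mathcomp Require Import all_boot all_order all_algebra all_fingroup.
From mathcomp Require Import zify.

Set Implicit Arguments.
Unset Strict Implicit.
Unset Printing Implicit Defensive.

(** Expanding every matrix as a multiple of G G^t, the trace becomes a sum, over
row indices and column indices, of products of 2n Gaussian entries, which are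
labelled by the elements of [±n].  By Wick's formula the expectation of such a
product counts the pairings of these labels that match only equal entries of
equally coloured matrices.  For a fixed pairing p the row indices are constant
on the orbits of the group generated by p and [delta * gamma_tilde], and the
column indices on those of the group generated by p and [delta]; the number of
orbits of the group generated by two pairings is half the number of cycles of
their product ([card_invariant]).  With t = [delta * p] this makes the expected
normalized trace the sum over t of

  N^-(n+1) N^(#(gamma_tilde t^-1)/2) M^(#(t)/2)

([wick_count], [mean_trace]).

The order of magnitude of a term is controlled by the genus inequality: two
permutations of T and their product have together at most |T| + 2z cycles, where
z is the number of orbits of the group they generate ([genus_bound]).  If t and
[gamma_tilde] generate a transitive group, then t and gamma_tilde t^-1 together
have at most 2n cycles, because [gamma_tilde] has two.  So the term is at most of
order 1/N, and it is of this order exactly for the annular non-crossing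
permutations of the second sum.  Otherwise t acts on the positive numbers by a
permutation a of the n indices and on the negative ones by its inverse.  Then the
term is (M/N)^#(a) N^(-e), where e = n + 1 - #(a) - #(krew a) is non-negative by
the same inequality, and even by comparing signatures ([krew_parity]).  So either
e = 0 or the term is at most of order N^-2, and the only contribution of order
1/N from these t comes from M/N = c + c'/N + o(1/N), which differentiates
c^#(a).

The permutations with e = 0 correspond to the non-crossing partitions through
their cycles ([sum_NC]).  In one direction, cutting the arc from x to [a x]
shows that no cycle leads out of the interval under the arc ([planar_nested]).
In the other direction, one compares the number of cycles of a and of [krew a]
with the number of their weak descents, of which there are n + 1 altogether
([card_wdesc]).

On the side of probability, the expectation of a product of independent
variables is the product of the expectations ([mean_prod_independent]), and
integration by parts gives the moments of the normal law ([normal_moment]). *)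

(** * Cycles of permutations and the genus inequality *)

Section Orbits.
Local Open Scope group_scope.
Variable T : finType.
Implicit Types (s t : {perm T}) (x y : T).

Lemma porbits1 : #|porbits (1 : {perm T})| = #|T|.
Proof.
rewrite card_imset // => x y /eqP.
by rewrite eq_porbit_mem => /porbitP[i ->]; rewrite expg1n perm1.
Qed.

Lemma porbit_step s x : porbit s (s x) = porbit s x.
Proof. by have := porbit_perm s 1 x; rewrite expg1. Qed.

Lemma mem_porbit_step s x y : (s y \in porbit s x) = (y \in porbit s x).
Proof. by rewrite -!eq_porbit_mem porbit_step. Qed.

Lemma porbit_closed (A : {pred T}) s x :
  {in A, forall y, s y \in A} -> x \in A -> {subset porbit s x <= A}.
Proof.
move=> As Ax _ /porbitP[i ->]; elim: i => [|i IHi]; first by rewrite perm1.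
by rewrite expgSr permM As.
Qed.

Lemma porbit_const (C : Type) (f : T -> C) s x y :
  (forall z, f (s z) = f z) -> y \in porbit s x -> f y = f x.
Proof.
move=> fs /porbitP[i ->]; elim: i => [|i IHi]; first by rewrite perm1.
by rewrite expgSr permM fs.
Qed.

Lemma porbitsJ s t : #|porbits (t^-1 * s * t)| = #|porbits s|.
Proof.
have E x : porbit (t^-1 * s * t) x = t @: porbit s (t^-1 x).
  have iterE i : (t^-1 * s * t) ^+ i = t^-1 * s ^+ i * t.
    by rewrite -mulgA -[in RHS]mulgA -!conjgE conjXg.
  apply/setP => y; apply/porbitP/imsetP => [[i ->]|[z /porbitP[i ->] ->]].
    by exists ((s ^+ i) (t^-1 x)); rewrite ?mem_porbit // iterE !permM.
  by exists i; rewrite iterE !permM.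
rewrite -(card_imset (mem (porbits s)) (imset_inj (@perm_inj _ t))).
congr #|pred_of_set _|; apply/setP => C; apply/imsetP/imsetP => [[x _ ->]|[D /imsetP[x _ ->] ->]].
  by exists (porbit s (t^-1 x)); rewrite ?imset_f.
by exists (t x) => //; rewrite E permK.
Qed.

Lemma porbits_mulC s t : #|porbits (s * t)| = #|porbits (t * s)|.
Proof. by rewrite -(porbitsJ (t * s) t) !mulgA mulVg mul1g. Qed.

Lemma porbits_tperm_split s x :
  s x != x -> #|porbits (tperm x (s x) * s)| = #|porbits s|.+1.
Proof.
move=> sx; have := porbits_mul_tperm s x (s x).
by rewrite porbit_step porbit_id /= addn0 eq_sym sx addn1.
Qed.

(** Building [a] up from the identity by transpositions [x y], each step lowers
the number of cycles of [a] by one.  It raises that of [a * b] by one when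
[x] and [y] already lie in one cycle of [a * b], so that [f] need not change;
otherwise it lowers that of [a * b] as well, and this pays for the class that
[f] loses when the classes of [x] and [y] are merged. *)
Lemma genus_bound (a b : {perm T}) :
  exists f : T -> {set T}, [/\ forall x, f (a x) = f x, forall x, f (b x) = f x
    & #|porbits a| + #|porbits b| + #|porbits (a * b)|
        <= #|T| + #|f @: [set: T]|.*2].
Proof.
have [m] := ubnP (#|T| - #|porbits a|).
elim: m a => // m IHm a; have [x ax|a1] := pickP (fun x => a x != x); last first.
  have -> : a = 1 by apply/permP=> x; rewrite perm1; apply/eqP/negbFE/a1.
  move=> _; exists (porbit b); split=> [x|x|]; first by rewrite perm1.
    exact: porbit_step.
  have le_b : #|porbits b| <= #|porbit b @: [set: T]|.
    apply/subset_leq_card/subsetP => _ /imsetP[y _ ->]; exact: imset_f.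
  by rewrite mul1g porbits1; lia.
have a1 : #|porbits (tperm x (a x) * a)| = #|porbits a|.+1.
  exact: porbits_tperm_split.
set y := a x in ax a1 *; pose a' : {perm T} := tperm x y * a.
rewrite -/a' in a1.
have le_a' : #|porbits a'| <= #|T| by rewrite (leq_trans (leq_imset_card _ _)) ?max_card.
move=> ltm; have [|f [fa fb le_f]] := IHm a'; first by lia.
have aE : a = tperm x y * a' by rewrite /a' mulgA tperm2 mul1g.
pose h z := if f z == f y then f x else f z.
have hxy : h x = h y by rewrite /h eqxx; case: eqP.
have hE z w : f z = f w -> h z = h w by rewrite /h => ->.
exists h; split=> [z|z|].
- rewrite aE permM; case: (tpermP x y z) => [->|->|_ _]; last by apply: hE.
    by rewrite hxy; apply: hE.
  by rewrite -hxy; apply: hE.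
- exact: hE.
have /= := porbits_mul_tperm (a' * b) x y; rewrite mulgA -aE eq_sym ax /=.
have im_h : f @: [set: T] \subset f y |: h @: [set: T].
  apply/subsetP=> _ /imsetP[z _ ->]; rewrite !inE; case: eqVneq => //= fz.
  by apply/imsetP; exists z; rewrite // /h (negbTE fz).
have [xy /=|_ /=] := boolP (x \in porbit (a' * b) y).
  have fxy : f x = f y.
    by apply: porbit_const xy => z; rewrite permM fb fa.
  have -> : h @: [set: T] = f @: [set: T].
    by apply: eq_imset => z; rewrite /h; case: eqP => // ->.
  have arith A A' B C C' m0 F : A' = A.+1 -> A' + B + C' <= m0 + F.*2 ->
    C + 0.*2 = C' + 1 -> A + B + C <= m0 + F.*2 by lia.
  exact: arith a1 le_f.
have arith A A' B C C' m0 F G : A' = A.+1 -> A' + B + C' <= m0 + F.*2 ->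
  F <= G.+1 -> C + 1.*2 = C' + 1 -> A + B + C <= m0 + G.*2 by lia.
apply: arith a1 le_f _; apply: leq_trans (subset_leq_card im_h) _.
by rewrite cardsU1 -add1n leq_add2r leq_b1.
Qed.

End Orbits.

(** * Planar permutations *)

Section Planar.
Local Open Scope group_scope.
Variable m : nat.
Local Notation n := m.+1.
Implicit Types (a : {perm 'I_n}) (x y z i : 'I_n).

Definition ncycle : {perm 'I_n} := perm (@ordS_inj n).

Lemma ncycleE i : i != ord_max -> ncycle i = i.+1 :> nat.
Proof.
move=> im; rewrite permE /= modn_small //.
have := ltn_ord i; have : i != m :> nat by apply: contraNneq im => im; apply/eqP/val_inj.
lia.
Qed.

Lemma ncycle_max : ncycle ord_max = ord0.
Proof. by apply: val_inj; rewrite permE /= modnn. Qed.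

Lemma ncycle_const (C : Type) (f : 'I_n -> C) i :
  (forall z, f (ncycle z) = f z) -> f i = f ord0.
Proof.
move=> fcyc; have [k] := ubnP i; elim: k i => // k IHk i lt_ik.
have [i0|i0] := posnP i; first by congr f; apply: val_inj.
have lt_i1 : i.-1 < n by have := ltn_ord i; lia.
rewrite -(IHk (Ordinal lt_i1)) -?[f (Ordinal _)]fcyc /=; last by lia.
congr f; apply: val_inj; rewrite /= ncycleE /= ?prednK //.
by rewrite -(inj_eq val_inj) /=; have := ltn_ord i; lia.
Qed.

Lemma porbits_ncycle : #|porbits ncycle| = 1%N.
Proof.
apply/eqP/cards1P; exists (porbit ncycle ord0); apply/setP=> C; rewrite inE.
apply/imsetP/eqP=> [[i _ ->]|->]; last by exists ord0.
by apply: ncycle_const => z; apply: porbit_step.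
Qed.

(** The Kreweras complement. *)
Definition krew a : {perm 'I_n} := ncycle * a^-1.

Lemma krewE a i : a (krew a i) = ncycle i.
Proof. by rewrite permM permKV. Qed.

(** Equality in [planar_le], that is, genus zero relative to the full cycle. *)
Definition planar a := #|porbits a| + #|porbits (krew a)| == n.+1.

(** The product of [krew a] and [a] is the full cycle, so that a function invariant
under both is constant and the genus bound has a single class. *)
Lemma planar_le a : #|porbits a| + #|porbits (krew a)| <= n.+1.
Proof.
have [f [fk fa]] := genus_bound (krew a) a.
rewrite mulgKV porbits_ncycle card_ord => /leq_trans le_f.
have im_f : f @: [set: 'I_n] \subset [set f ord0].
  apply/subsetP=> _ /imsetP[i _ ->]; rewrite inE; apply/eqP/ncycle_const=> z.
  by rewrite -(krewE a) fa fk.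
have := subset_leq_card im_f; rewrite cards1.
have arith A B F : B + A + 1 <= n + F.*2 -> F <= 1 -> A + B <= n.+1 by lia.
exact/arith/le_f.
Qed.

Definition wdesc a : {set 'I_n} := [set x | a x <= x].

(** The largest element of a cycle is a weak descent. *)
Lemma porbits_wdesc a : porbits a = porbit a @: wdesc a.
Proof.
apply/setP=> C; apply/imsetP/imsetP=> [[x _ ->]|[x _ ->]]; last by exists x.
have [y xy ymax] := @arg_maxnP _ x [in porbit a x] (@nat_of_ord n) (porbit_id a x).
exists y; first by rewrite inE; apply: ymax; rewrite mem_porbit_step.
by apply/eqP; rewrite eq_sym eq_porbit_mem.
Qed.

Lemma card_porbits_wdesc a : #|porbits a| <= #|wdesc a|.
Proof. by rewrite porbits_wdesc leq_imset_card. Qed.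

(** [krew a] maps its weak descents, the last index apart, bijectively onto the
strict ascents of [a]. *)
Lemma card_wdesc a : #|wdesc a| + #|wdesc (krew a)| = n.+1.
Proof.
have max_wd : ord_max \in wdesc (krew a) by rewrite inE -ltnS.
rewrite (cardsD1 ord_max (wdesc (krew a))) max_wd.
have <- := card_imset (wdesc (krew a) :\ ord_max) (@perm_inj _ (krew a)).
suff -> : krew a @: (wdesc (krew a) :\ ord_max) = ~: wdesc a.
  by rewrite add1n addnS cardsC card_ord.
apply/setP=> x; rewrite -[x](permKV (krew a)); move: (_ x) => {}x.
rewrite mem_imset; last exact: perm_inj.
rewrite !inE krewE -ltnNge.
have [->|/ncycleE->] := eqVneq x ord_max; first by rewrite ncycle_max.
by rewrite ltnS.
Qed.

(** Cycles are at most as many as weak descents, for [a] and for [krew a]; these two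
bounds add up to [n.+1], so that planarity turns both into equalities. *)
Lemma planar_wdesc_inj a : planar a ->
  {in wdesc a &, injective (porbit a)}.
Proof.
move=> /eqP pa; apply/imset_injP; rewrite -porbits_wdesc.
have := card_porbits_wdesc a; have := card_porbits_wdesc (krew a).
by have := card_wdesc a; lia.
Qed.

(** For permutations with one weak descent per cycle, this means running in
increasing order through the blocks of a non-crossing partition. *)
Definition nested a := forall x y z,
  x < y < a x -> z \in porbit a y -> x < z < a x.

(** When [x < a x], the interval from [x] to the predecessor of [a x] is stable under
[krew a].  Hence no cycle of [krew a] has two weak descents either, and cycles and
weak descents are equally many for both permutations. *)
Lemma nested_planar a : nested a ->
  {in wdesc a &, injective (porbit a)} -> planar a.
Proof.
move=> nest inj_a; rewrite /planar; apply/eqP/anti_leq; rewrite planar_le /=.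
rewrite -(card_wdesc a) (porbits_wdesc a) (card_in_imset inj_a) leq_add2l.
rewrite porbits_wdesc card_in_imset // => x y.
have closed x0 z : x0 \in wdesc (krew a) -> x0 != ord_max ->
    z \in porbit (krew a) x0 -> z <= x0.
  rewrite inE => le_x0 x0max zx0.
  pose A := [pred i : 'I_n | krew a x0 <= i <= x0].
  suff /andP[] : z \in A by [].
  apply: (porbit_closed (A := A) _ _ zx0); last by rewrite inE le_x0 leqnn.
  move=> i /andP[le1 le2]; rewrite inE.
  have aE := krewE a x0; have rE := ncycleE x0max.
  have [->|ix0] := eqVneq i x0; first by rewrite leqnn.
  have imax : i != ord_max.
    apply: contraNneq x0max => imax; rewrite -val_eqE /=.
    by move: le2; rewrite imax /=; have := ltn_ord x0; lia.
  have := nest (krew a x0) (ncycle i) (krew a i).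
  have -> : krew a i \in porbit a (ncycle i) by rewrite -(krewE a i) porbit_step porbit_id.
  rewrite aE rE ncycleE // ltnS le1 ltnS ltn_neqAle ix0 le2 => /(_ isT isT).
  by case/andP=> /ltnW->.
move=> wx wy xy.
have yx : y \in porbit (krew a) x by rewrite xy porbit_id.
have xy' : x \in porbit (krew a) y by rewrite -xy porbit_id.
apply/val_inj/anti_leq/andP; split.
- have [->|ymax] := eqVneq y ord_max; last exact: closed.
  exact: leq_ord.
- have [->|xmax] := eqVneq x ord_max; last exact: closed.
  exact: leq_ord.
Qed.

(** Cutting an arc: composing both [a] and [ncycle] with the transposition of the
two ends of the arc from [x] to [a x] makes [x] a fixed point of the first and
splits the second into the interval from [x] to the predecessor of [a x] and its
complement.  For planar [a] the cycle count then exceeds the genus bound of a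
single class, so that [a] cannot lead out of the interval. *)
Lemma planar_nested a : planar a -> nested a.
Proof.
move=> /eqP pa x y z xyax; apply: (porbit_closed (A := [pred i : 'I_n | x < i < a x])) => //.
move=> {xyax}y; rewrite !inE => /andP[xy yax].
have xax : a x != x by rewrite -val_eqE /=; lia.
pose t := tperm x (a x); pose b := a * t; pose g := ncycle * t.
have bP : #|porbits b| = #|porbits a|.+1.
  rewrite porbits_mulC; exact: porbits_tperm_split.
have gP : #|porbits g| = 2%N.
  rewrite porbits_mulC; have := porbits_mul_tperm ncycle x (a x).
  suff -> : x \in porbit ncycle (a x) by rewrite porbits_ncycle /= eq_sym xax /= addn0.
  rewrite -eq_porbit_mem; apply/eqP; transitivity (porbit ncycle ord0).
    by apply: ncycle_const => i; apply: porbit_step.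
  by apply/esym/ncycle_const => i; apply: porbit_step.
have kE : krew a * b = g by rewrite /b mulgA mulgKV.
have [f [fk fb]] := genus_bound (krew a) b.
rewrite kE gP bP card_ord => le_f.
have fg i : f (g i) = f i by rewrite -kE permM fb fk.
have f_in k (lt_kn : k < n) : x <= k -> k < a x -> f (Ordinal lt_kn) = f x.
  elim: k lt_kn => [|k IHk] lt_kn xk kax; first by congr f; apply: val_inj => /=; lia.
  move: xk; rewrite leq_eqVlt => /orP[/eqP xk|xk].
    by congr f; apply: val_inj.
  rewrite -(IHk (ltnW lt_kn)) //; last by lia.
  rewrite -[in RHS]fg; congr f; apply: val_inj; rewrite permM.
  have kE' : ncycle (Ordinal (ltnW lt_kn)) = k.+1 :> nat.
    by rewrite ncycleE // -val_eqE /=; lia.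
  rewrite tpermD ?kE' // -val_eqE /= kE'; lia.
have f_hi k (lt_kn : k < n) : a x <= k -> f (Ordinal lt_kn) = f (a x).
  elim: k lt_kn => [|k IHk] lt_kn xk; first by lia.
  move: xk; rewrite leq_eqVlt => /orP[/eqP xk|xk].
    by congr f; apply: val_inj.
  rewrite -(IHk (ltnW lt_kn)) //.
  rewrite -[in RHS]fg; congr f; apply: val_inj; rewrite permM.
  have kE' : ncycle (Ordinal (ltnW lt_kn)) = k.+1 :> nat.
    by rewrite ncycleE // -val_eqE /=; lia.
  rewrite tpermD ?kE' // -val_eqE /= kE'; lia.
have f_lo k (lt_kn : k < n) : k < x -> f (Ordinal lt_kn) = f (a x).
  move dE : (x - k)%N => d; elim: d k lt_kn dE => [|d IHd] k lt_kn dE ltkx; first by lia.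
  have kE' : ncycle (Ordinal lt_kn) = k.+1 :> nat.
    by rewrite ncycleE // -val_eqE /=; have := ltn_ord x; lia.
  rewrite -fg permM; have [k1x|k1x] := eqVneq k.+1 (x : nat).
    have -> : ncycle (Ordinal lt_kn) = x by apply: val_inj; rewrite /= kE'.
    by rewrite tpermL.
  rewrite tpermD; first last.
  - by rewrite -val_eqE /= kE'; lia.
  - by rewrite -val_eqE /= kE' eq_sym.
  have lt_k1 : k.+1 < n by have := ltn_ord x; lia.
  rewrite -(IHd _ lt_k1); [congr f; apply: val_inj | lia | lia].
  by rewrite /= kE'.
have f_out i : ~~ (x <= i < a x) -> f i = f (a x).
  case: i => k lt_kn /=; rewrite negb_and -ltnNge -leqNgt => /orP[]; [exact: f_lo|exact: f_hi].
(* By [f_in] and [f_out] these are the only values of [f]; if they were equal, the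
   genus bound would be violated. *)
have f_ne : f x != f (a x).
  apply/negP=> /eqP fxx.
  have im_f : f @: [set: 'I_n] \subset [set f x].
    apply/subsetP=> _ /imsetP[[k lt_kn] _ ->]; rewrite inE; apply/eqP.
    by have [/andP[]|/f_out->//] := boolP (x <= Ordinal lt_kn < a x); apply: f_in.
  have := subset_leq_card im_f; rewrite cards1.
  by move: le_f pa; lia.
have fby : f (b y) = f x.
  by rewrite fb; case: (y) xy yax => k lt_kn /= xk kax; rewrite f_in // ltnW.
have by_in : x <= b y < a x.
  by apply: contraNT f_ne => /f_out byE; rewrite -fby byE.
have ayx : a y != a x by rewrite (inj_eq perm_inj) -val_eqE /=; lia.
have byx : b y != x.
  have -> : x = t (a x) by rewrite tpermR.
  by rewrite permM (inj_eq perm_inj).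
move: by_in byx; rewrite (_ : b y = t (a y)); last by rewrite permM.
rewrite /t; case: tpermP => [_|/eqP|_ _].
- by rewrite ltnn andbF.
- by rewrite (negPf ayx).
- by case/andP=> le_x -> ne_x; rewrite andbT ltn_neqAle eq_sym ne_x.
Qed.

End Planar.

(** * Non-crossing partitions *)

Lemma partition_porbits (T : finType) (s : {perm T}) :
  partition (porbits s) [set: T].
Proof.
apply/and3P; split.
- apply/eqP/setP=> x; rewrite inE; apply/bigcupP; exists (porbit s x).
    exact: imset_f.
  exact: porbit_id.
- apply/trivIsetP=> _ _ /imsetP[x _ ->] /imsetP[y _ ->]; apply: contraR.
  case/pred0Pn=> z /andP[/= xz yz].
  by rewrite -(eqP (_ : porbit s z == porbit s x)) eq_porbit_mem.
- apply/negP=> /imsetP[x _ s0]; have := porbit_id s x.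
  by rewrite -s0 inE.
Qed.

Lemma pblock_porbits (T : finType) (s : {perm T}) x :
  pblock (porbits s) x = porbit s x.
Proof.
have /and3P[_ tI _] := partition_porbits s.
by apply: def_pblock; rewrite ?porbit_id ?imset_f.
Qed.

Lemma imset_pblock (T : finType) (p : {set {set T}}) :
  partition p [set: T] -> pblock p @: [set: T] = p.
Proof.
case/and3P=> /eqP cp tI p0; apply/setP=> B; apply/imsetP/idP=> [[x _ ->]|pB].
  by apply: pblock_mem; rewrite cp inE.
have [B0|[x xB]] := set_0Vmem B; first by rewrite -B0 pB in p0.
by exists x; rewrite ?inE // (def_pblock tI pB).
Qed.

Section NonCrossing.
Local Open Scope group_scope.
Variable m : nat.
Local Notation n := m.+1.
Implicit Types (a : {perm 'I_n}) (x y z i : 'I_n) (B : {set 'I_n}) (p : {set {set 'I_n}}).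

(** The second alternative is the return from the largest element of [B] to the
smallest. *)
Definition is_next B x z := (z \in B) &&
  ((x < z) && [forall y in B, ~~ (x < y < z)]
   || [forall y in B, (y <= x) && (z <= y)]).

Lemma is_nextP B x z : reflect
  (z \in B /\ ((x < z /\ (forall y, y \in B -> ~~ (x < y < z)))
     \/ (forall y, y \in B -> y <= x /\ z <= y)))
  (is_next B x z).
Proof.
apply: (iffP andP) => -[zB nz]; split=> //.
  case/orP: nz => [/andP[xz /forall_inP nz]|/forall_inP nz]; [left|right] => //.
  by move=> y /nz/andP.
apply/orP; case: nz => [[xz nz]|nz]; [left|right].
  by rewrite xz; apply/forall_inP.
by apply/forall_inP=> y /nz[-> ->].
Qed.

Lemma is_next_fun B x z z' : is_next B x z -> is_next B x z' -> z = z'.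
Proof.
move=> /is_nextP[zB nz] /is_nextP[zB' nz']; apply/val_inj => /=.
case: nz nz' => [[xz nz]|nz] [[xz' nz']|nz'].
- by have := nz _ zB'; have := nz' _ zB; lia.
- by have := nz' _ zB; lia.
- by have := nz _ zB'; lia.
- by have := nz _ zB'; have := nz' _ zB; lia.
Qed.

Lemma is_next_inj B x y z : x \in B -> y \in B ->
  is_next B x z -> is_next B y z -> x = y.
Proof.
move=> xB yB /is_nextP[zB nz] /is_nextP[_ nz']; apply/val_inj => /=.
case: nz nz' => [[xz nz]|nz] [[xz' nz']|nz'].
- by have := nz _ yB; have := nz' _ xB; lia.
- by have := nz' _ xB; lia.
- by have := nz _ yB; lia.
- by have := nz _ yB; have := nz' _ xB; lia.
Qed.

Lemma is_next_ex B x : x \in B -> exists z, is_next B x z.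
Proof.
move=> xB; have [y /andP[yB xy]|nogt] := pickP [pred y in B | x < y].
  have [|z /andP[zB xz] zmin] := @arg_minnP _ y [pred y in B | x < y] (@nat_of_ord n).
    by rewrite inE yB.
  exists z; apply/is_nextP; split=> //; left; split=> // t tB.
  by apply/negP=> /andP[xt]; rewrite ltnNge zmin // inE tB.
have [z zB zmin] := @arg_minnP _ x [in B] (@nat_of_ord n) xB.
exists z; apply/is_nextP; split=> //; right=> y yB; split; last exact: zmin.
by rewrite leqNgt; have := nogt y; rewrite inE yB /= => ->.
Qed.

(** The single weak descent of a cycle is its largest element, and leads to the
smallest one; the other steps are ascents, with nothing of the cycle under their
arcs. *)
Lemma planar_next a x : planar a -> is_next (porbit a x) x (a x).
Proof.
move=> pa; apply/is_nextP; split; first by rewrite mem_porbit_step porbit_id.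
have nest := planar_nested pa; have inj_a := planar_wdesc_inj pa.
have [xax|axx] := ltnP x (a x); [left|right].
  split=> // y xy; apply/negP=> /nest nest_y; have := nest_y x.
  by rewrite porbit_sym xy ltnn => /(_ isT).
move=> y yx; have xw : x \in wdesc a by rewrite inE.
have [M Mx Mmax] := @arg_maxnP _ x [in porbit a x] (@nat_of_ord n) (porbit_id a x).
have [i ix imin] := @arg_minnP _ x [in porbit a x] (@nat_of_ord n) (porbit_id a x).
have eq_x z : z \in porbit a x -> z \in wdesc a -> z = x.
  by move=> zx zw; apply: inj_a => //; apply/eqP; rewrite eq_porbit_mem.
have <- : M = x.
  by apply: eq_x => //; rewrite inE; apply: Mmax; rewrite mem_porbit_step.
split; first exact: Mmax.
suff -> : a M = i by exact: imin.
have Mx' : M = x.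
  by apply: eq_x => //; rewrite inE; apply: Mmax; rewrite mem_porbit_step.
rewrite Mx' -(eq_x (a^-1 i)) ?permKV //.
  by rewrite -(mem_porbit_step a) permKV.
rewrite inE permKV; apply: imin.
by rewrite -(mem_porbit_step a) permKV.
Qed.

Lemma planar_porbits_inj : {in [pred a | planar a] &, injective (@porbits 'I_n)}.
Proof.
move=> a b pa pb ab; apply/permP=> x.
apply: is_next_fun (planar_next x pa) _.
by rewrite -(pblock_porbits a) ab pblock_porbits; apply: planar_next.
Qed.

(** At a crossing [u < v < u' < v'], the arc of [B] from its last element before [v]
passes over [v] but not over [v'], whereas the cycle of [v] stays under it. *)
Lemma planar_NC a : planar a -> porbits a \in NC n.
Proof.
move=> pa; rewrite inE partition_porbits /=.
apply/forall_inP=> _ /imsetP[x0 _ ->]; set B := porbit a x0.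
apply/forall_inP=> C Cp; apply/implyP=> BC.
apply/forall_inP=> u uB; apply/forall_inP=> v vC.
apply/forall_inP=> u' u'B; apply/forall_inP=> v' v'C.
apply/and3P=> -[uv vu' u'v'].
have {}Cp : C = porbit a v.
  case/imsetP: Cp vC => y0 _ -> vC; apply/eqP.
  by rewrite eq_sym eq_porbit_mem.
have [|x /andP[xB xv] xmax] := @arg_maxnP _ u [pred y in B | y < v] (@nat_of_ord n).
  by rewrite inE uB.
have Bx : B = porbit a x by apply/eqP; rewrite eq_sym eq_porbit_mem.
have /is_nextP[axB] := planar_next x pa; rewrite -Bx => -[[xax nz]|nz].
  have vax : v < a x.
    rewrite ltnNge leq_eqVlt negb_or; apply/andP; split; last first.
      apply/negP=> axv; have := xmax (a x); rewrite inE Bx axB axv => /(_ isT) /= le_ax.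
      by move: xax; rewrite ltnNge le_ax.
    apply: contra BC => /eqP/val_inj axv.
    by rewrite Bx Cp -axv porbit_step.
  have := planar_nested pa (x := x) (y := v) (z := v').
  by rewrite xv vax -Cp v'C => /(_ isT isT); have := nz _ u'B; lia.
by have [] := nz _ u'B; lia.
Qed.

(** The permutation running through each block in increasing cyclic order. *)
Lemma NC_planar p : p \in NC n -> exists2 a, planar a & porbits a = p.
Proof.
rewrite inE => /andP[pp ncp]; have /and3P[/eqP cp tI p0] := pp.
have xp x : x \in pblock p x by rewrite mem_pblock cp inE.
have pblockE x y : y \in pblock p x -> pblock p y = pblock p x.
  by move=> yx; apply/eqP; rewrite eq_sym eq_pblock // cp inE.
have nextP x : is_next (pblock p x) x (xchoose (is_next_ex (xp x))).
  exact: xchooseP.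
set nxt := fun x => xchoose (is_next_ex (xp x)) in nextP.
have nxt_p x : pblock p (nxt x) = pblock p x.
  by apply: pblockE; case/andP: (nextP x).
have nxt_inj : injective nxt.
  move=> x y xy; apply: (@is_next_inj (pblock p x) _ _ (nxt x)) => //.
    by rewrite -nxt_p xy nxt_p.
  by rewrite -nxt_p xy nxt_p.
pose a := perm nxt_inj; have aE x : a x = nxt x by rewrite permE.
have {nextP} nextP x : is_next (pblock p x) x (a x) by rewrite aE.
have wd_max w y : w \in wdesc a -> y \in pblock p w -> y <= w.
  rewrite inE => aw yw; have /is_nextP[_ [[lt_w _]|nz]] := nextP w.
    by rewrite ltnNge aw in lt_w.
  by case: (nz y yw).
have orb_p x y : y \in porbit a x -> pblock p y = pblock p x.
  by apply: porbit_const => z; rewrite aE.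
have wd_eq w w' : w \in wdesc a -> w' \in wdesc a ->
    pblock p w = pblock p w' -> w = w'.
  move=> ww ww' E; apply/val_inj/anti_leq.
  by rewrite !wd_max // ?E // -E.
have orbE x : porbit a x = pblock p x.
  apply/setP=> y; apply/idP/idP=> [/orb_p<- //|yx].
  have wdx t : exists2 w, w \in wdesc a & w \in porbit a t.
    have : porbit a t \in porbits a by apply: imset_f.
    rewrite porbits_wdesc => /imsetP[w ww ->]; exists w => //; exact: porbit_id.
  have [[w ww wx] [w' ww' wy]] := (wdx x, wdx y).
  have ww'E : w = w'.
    by apply: wd_eq => //; rewrite (orb_p _ _ wx) (orb_p _ _ wy) (pblockE _ _ yx).
  rewrite -ww'E in wy.
  have /eqP<- : porbit a w == porbit a x by rewrite eq_porbit_mem.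
  by rewrite porbit_sym.
exists a; last first.
  rewrite -[RHS]imset_pblock //; apply/setP=> C.
  by apply/imsetP/imsetP=> -[x _ ->]; exists x; rewrite ?inE ?orbE.
apply: nested_planar; last first.
  by move=> x y xw yw; rewrite !orbE; apply: wd_eq.
move=> x y z xyax; apply: (porbit_closed (A := [pred i : 'I_n | x < i < a x])) => //.
move=> {xyax}y; rewrite !inE => /andP[xy yax].
have /is_nextP[axB nz] := nextP x.
have {nz} nz t : t \in pblock p x -> ~~ (x < t < a x).
  case: nz => [[_ nz]|nz]; first exact: nz.
  by case/nz; lia.
have yNx : y \notin pblock p x by apply: contraL isT => /nz; rewrite xy yax.
have ayNx : a y \notin pblock p x.
  by apply: contra yNx => /pblockE<-; rewrite aE nxt_p.
have ne : pblock p x != pblock p y by apply: contraNneq yNx => ->.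
have ayB : a y \in pblock p y by case/andP: (nextP y).
have ncE B C u v u' v' : B \in p -> C \in p -> B != C -> u \in B -> v \in C ->
    u' \in B -> v' \in C -> ~~ [&& u < v, v < u' & u' < v'].
  move=> pB pC BC uB vC u'B v'C; move/forall_inP/(_ _ pB)/forall_inP/(_ _ pC): ncp.
  by rewrite BC => /forall_inP/(_ _ uB)/forall_inP/(_ _ vC)
    /forall_inP/(_ _ u'B)/forall_inP/(_ _ v'C).
have pp' t : pblock p t \in p by apply: pblock_mem; rewrite cp inE.
have nc1 := ncE _ _ x y (a x) (a y) (pp' x) (pp' y) ne (xp x) (xp y) axB ayB.
rewrite eq_sym in ne.
have nc2 := ncE _ _ (a y) x y (a x) (pp' y) (pp' x) ne ayB (xp x) (xp y) axB.
have ayx : a y != x :> nat by apply: contraNneq ayNx => /val_inj->.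
have ayax : a y != a x :> nat by apply: contraNneq ayNx => /val_inj->.
by move: nc1 nc2 ayx ayax xy yax; lia.
Qed.

Lemma NC_porbits : NC n = @porbits 'I_n @: [set a | planar a].
Proof.
apply/setP=> p; apply/idP/imsetP=> [/NC_planar[a pa <-]|[a]].
  by exists a; rewrite ?inE.
by rewrite inE => pa ->; apply: planar_NC.
Qed.

Lemma sum_NC (V : nmodType) (Q : pred {set {set 'I_n}}) (F : {set {set 'I_n}} -> V) :
  (\sum_(p in NC n | Q p) F p = \sum_(a | planar a && Q (porbits a)) F (porbits a))%R.
Proof.
rewrite big_mkcondr NC_porbits big_imset /=; last first.
  by move=> a b; rewrite !inE => pa pb; apply: planar_porbits_inj.
by rewrite [RHS]big_mkcondr; apply: eq_bigl => a; rewrite inE.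
Qed.

End NonCrossing.

(** * Pairings *)

Section FactorCount.
Local Open Scope group_scope.
Variables (T C : finType).

Lemma card_factoring (f : T -> C) (N : nat) :
  #|[set h : {ffun T -> 'I_N} | [forall x, forall y, (f x == f y) ==> (h x == h y)]]|
    = (N ^ #|f @: [set: T]|)%N.
Proof.
pose S := {c : C | c \in f @: [set: T]}.
have fS x : f x \in f @: [set: T] by rewrite imset_f ?inE.
pose ext (g : {ffun S -> 'I_N}) : {ffun T -> 'I_N} := [ffun x => g (exist _ (f x) (fS x))].
have ext_inj : injective ext.
  move=> g g' /ffunP gg'; apply/ffunP=> c; have /imsetP[x _ cx] := valP c.
  have <- : exist _ (f x) (fS x) = c by exact: val_inj.
  by have := gg' x; rewrite !ffunE.
transitivity #|ext @: [set: {ffun S -> 'I_N}]|; last first.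
  have -> := card_imset [set: {ffun S -> 'I_N}] ext_inj.
  by rewrite cardsT card_ffun card_ord card_sig; congr (_ ^ _)%N; apply: eq_card.
apply: eq_card => h; rewrite inE; apply/idP/imsetP=> [hf|[g _ ->]].
  have hfE x y : f x = f y -> h x = h y.
    by move=> xy; move/forallP/(_ x)/forallP/(_ y)/implyP: hf => /(_ _)/eqP->; rewrite ?xy.
  have pick_x (c : S) : {x | f x = val c}.
    have [x /eqP xc|nox] := pickP (fun x => f x == val c); first by exists x.
    by exfalso; have /imsetP[x _ cx] := valP c; have := nox x; rewrite -cx eqxx.
  exists [ffun c => h (sval (pick_x c))] => //.
  apply/ffunP=> x; rewrite !ffunE; apply: hfE.
  by case: (pick_x _) => y /= ->.
apply/forallP=> x; apply/forallP=> y; apply/implyP=> /eqP xy.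
by apply/eqP; rewrite !ffunE; congr (g _); apply: val_inj.
Qed.

End FactorCount.

Section Pairings.
Local Open Scope group_scope.
Variable T : finType.
Implicit Types (p q s : {perm T}) (x y : T).

Definition pairing p := [forall x, (p (p x) == x) && (p x != x)].

Lemma pairingP p : reflect ((forall x, p (p x) = x) /\ (forall x, p x != x)) (pairing p).
Proof.
apply: (iffP forallP) => [pp|[pK pN] x]; last by rewrite pK eqxx pN.
by split=> x; have /andP[/eqP] := pp x.
Qed.

Lemma porbit_pairing p x : pairing p -> porbit p x = [set x; p x].
Proof.
case/pairingP=> pK _; apply/eqP; rewrite eqEsubset; apply/andP; split.
  apply/subsetP=> y; apply: porbit_closed => [z|]; rewrite !inE ?eqxx //.
  by case/pred2P=> ->; rewrite ?pK eqxx ?orbT.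
by rewrite subUset !sub1set porbit_id mem_porbit_step porbit_id.
Qed.

Lemma pairing_card_porbits p : pairing p = [forall C in porbits p, #|C| == 2].
Proof.
apply/idP/forall_inP=> [pp _ /imsetP[x _ ->]|p2].
  rewrite porbit_pairing // cards2; case/pairingP: pp => _ /(_ x).
  by rewrite eq_sym => ->.
apply/forallP=> x; have /eqP px2 : #|porbit p x| == 2 by rewrite p2 ?imset_f.
have := iter_porbit p x; rewrite px2 /= => ->; rewrite eqxx /=.
apply: contra_eqN px2 => /eqP pxx.
suff -> : porbit p x = [set x] by rewrite cards1.
apply/eqP; rewrite eqEsubset sub1set porbit_id andbT.
by apply/subsetP=> y; apply: porbit_closed => [z|]; rewrite !inE // => /eqP->; rewrite pxx.
Qed.

(** If [p x = r ^+ k x] with [r = p * q], then also [p y = r ^+ (k - 2) y] for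
[y = r x]; descending to [k = 0] or [k = 1] gives a fixed point of [p] or of
[q]. *)
Lemma pairings_porbit p q x : pairing p -> pairing q -> p x \notin porbit (p * q) x.
Proof.
move=> /pairingP[pK pN] /pairingP[qK qN]; apply/negP=> /porbitP[k]; move: x.
have : forall z, (p * q) z = q (p z) by move=> z; rewrite permM.
move: (p * q) => r rE; have [j] := ubnP k.
elim: j k => // j IHj [|[|k]] lt_k x.
- by rewrite perm1 => /eqP; rewrite (negPf (pN x)).
- by rewrite expg1 rE => /eqP; rewrite eq_sym (negPf (qN _)).
move=> pxE; apply: (IHj k _ (r x)); first by lia.
apply: (@perm_inj _ r); by rewrite [LHS]rE {1}rE pK qK pxE expgSr expgS !permM.
Qed.

End Pairings.

Section TwoPairings.
Local Open Scope group_scope.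
Variables (T : finType) (p q : {perm T}).
Hypotheses (pp : pairing p) (pq : pairing q).

(** The orbit of [x] under the group generated by [p] and [q]. *)
Definition dihedral_orbit x := porbit (p * q) x :|: porbit (p * q) (p x).

Lemma dihedral_orbit_p x : dihedral_orbit (p x) = dihedral_orbit x.
Proof. by rewrite /dihedral_orbit setUC; case/pairingP: pp => ->. Qed.

Lemma dihedral_orbit_r x : dihedral_orbit ((p * q) x) = dihedral_orbit x.
Proof.
have [pK _] := pairingP _ pp; have [qK _] := pairingP _ pq.
rewrite /dihedral_orbit porbit_step; congr (_ :|: _).
by rewrite -[LHS]porbit_step ![(p * q) _]permM pK qK.
Qed.

Lemma dihedral_orbit_q x : dihedral_orbit (q x) = dihedral_orbit x.
Proof.
have [pK _] := pairingP _ pp.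
by rewrite -[RHS]dihedral_orbit_p -[RHS]dihedral_orbit_r permM pK.
Qed.

Lemma card_porbits_pairings :
  #|porbits (p * q)| = #|dihedral_orbit @: [set: T]|.*2.
Proof.
have [pK _] := pairingP _ pp.
pose D (C : {set T}) := cover [set dihedral_orbit x | x in C].
have DE x : D (porbit (p * q) x) = dihedral_orbit x.
  apply/setP=> y; apply/bigcupP/idP=> [[_ /imsetP[z xz ->]]|yx].
    suff -> : dihedral_orbit z = dihedral_orbit x by [].
    exact: (porbit_const dihedral_orbit_r).
  by exists (dihedral_orbit x) => //; rewrite imset_f ?porbit_id.
rewrite -sum1_card (partition_big D (mem (dihedral_orbit @: [set: T]))) /=; last first.
  by move=> _ /imsetP[x _ ->]; rewrite DE imset_f ?inE.
rewrite (eq_bigr (fun=> 2%N)); last first.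
  move=> _ /imsetP[x _ ->].
  rewrite (eq_bigl (mem [set porbit (p * q) x; porbit (p * q) (p x)])).
    rewrite sum1_card cards2 eq_porbit_mem.
    by rewrite porbit_sym (negPf (pairings_porbit x pp pq)).
  move=> C; rewrite !inE; apply/andP/orP=> [[/imsetP[z _ ->]]|].
    rewrite DE => /eqP zx; have : z \in dihedral_orbit x.
      by rewrite -zx inE porbit_id.
    by rewrite inE -!eq_porbit_mem => /orP.
  by case=> /eqP->; rewrite imset_f // DE ?dihedral_orbit_p.
by rewrite sum_nat_const muln2.
Qed.

(** Functions invariant under [p] and [q] are those constant on the orbits of
the dihedral group generated by [p] and [q]; each such orbit is the union of two
cycles of [p * q], interchanged by [p]. *)
Lemma card_invariant (N : nat) :
  #|[set h : {ffun T -> 'I_N} | [forall x, (h (p x) == h x) && (h (q x) == h x)]]|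
    = (N ^ #|porbits (p * q)|./2)%N.
Proof.
rewrite card_porbits_pairings doubleK -card_factoring; apply: eq_card => h.
rewrite !inE; apply/forallP/forallP=> [hpq x|hD x].
  have hp z : h (p z) = h z by have /andP[/eqP] := hpq z.
  have hr z : h ((p * q) z) = h z.
    by have /andP[_ /eqP] := hpq (p z); rewrite permM hp.
  apply/forallP=> y; apply/implyP=> /eqP xy.
  have : x \in dihedral_orbit y by rewrite -xy inE porbit_id.
  by rewrite inE => /orP[]/(porbit_const hr)->; rewrite ?hp.
have hE z w : dihedral_orbit z = dihedral_orbit w -> h z == h w.
  by move=> zw; have /forallP/(_ w)/implyP := hD z; rewrite zw; apply.
by rewrite !hE ?dihedral_orbit_p ?dihedral_orbit_q.
Qed.

End TwoPairings.

(** The recursion chooses the partner of one point.  These numbers are also the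
moments of the standard normal law. *)
Fixpoint num_matchings (k : nat) : nat :=
  match k with 0 => 1 | 1 => 0 | k'.+2 => k'.+1 * num_matchings k' end.

Section CountPairings.
Local Open Scope group_scope.
Variables (T I : finType) (v : T -> I).
Implicit Types (p q : {perm T}) (x y : T) (A : {set T}).

Definition pairing_on A p := perm_on A p &&
  [forall x in A, [&& p (p x) == x, p x != x & v (p x) == v x]].

Definition mult A e := #|[set x in A | v x == e]|.

Lemma pairing_onP A p : reflect (perm_on A p /\ forall x, x \in A ->
  [/\ p (p x) = x, p x != x & v (p x) = v x]) (pairing_on A p).
Proof.
apply: (iffP andP) => -[pA pp]; split=> //.
  by move=> x xA; have /forall_inP/(_ x xA)/and3P[/eqP-> -> /eqP->] := pp.
by apply/forall_inP=> x /pp[-> -> ->]; rewrite !eqxx.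
Qed.

(** Multiplication by the transposition of [x] and [y] removes or adds the pair they
form. *)
Lemma card_pairing_on_fix A x y : x \in A -> y \in A -> x != y -> v x = v y ->
  #|[set p | pairing_on A p && (p x == y)]| = #|[set p | pairing_on (A :\ x :\ y) p]|.
Proof.
move=> xA yA xy vxy; pose t := tperm x y.
rewrite -[RHS](card_imset _ (mulgI t)); apply: eq_card => p.
rewrite !inE; apply/andP/imsetP=> [[/pairing_onP[pA pp] /eqP px]|[p' ]].
  have [ppx _ _] := pp x xA; rewrite px in ppx.
  have tp z : z != x -> z != y -> (t * p) z = p z.
    by move=> zx zy; rewrite permM tpermD // eq_sym.
  have tpx : (t * p) x = x by rewrite permM tpermL.
  have tpy : (t * p) y = y by rewrite permM tpermR.
  exists (t * p); last by rewrite mulgA tperm2 mul1g.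
  rewrite inE; apply/pairing_onP; split.
    apply/subsetP=> z; rewrite !inE; have [->|zy] := eqVneq z y.
      by rewrite tpy eqxx.
    have [->|zx] := eqVneq z x; first by rewrite tpx eqxx.
    by rewrite tp //=; move/subsetP: pA; apply.
  move=> z; rewrite !inE => /and3P[zy zx zA]; have [ppz pzz vpz] := pp z zA.
  have pzx : p z != x by rewrite -ppx (inj_eq perm_inj).
  have pzy : p z != y by rewrite -px (inj_eq perm_inj).
  by rewrite !tp.
rewrite inE => /pairing_onP[pA pp] ->.
have p'x : p' x = x by apply: (out_perm pA); rewrite !inE eqxx /= andbF.
have p'y : p' y = y by apply: (out_perm pA); rewrite !inE eqxx.
have tp z : z != x -> z != y -> (t * p') z = p' z.
  by move=> zx zy; rewrite permM tpermD // eq_sym.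
have tpx : (t * p') x = y by rewrite permM tpermL.
have tpy : (t * p') y = x by rewrite permM tpermR.
rewrite tpx eqxx; split=> //; apply/pairing_onP; split.
  apply/subsetP=> z; have [->//|zy] := eqVneq z y.
  have [->//|zx] := eqVneq z x; rewrite inE tp // => p'z.
  by have := subsetP pA z; rewrite !inE p'z => /(_ isT)/and3P[].
move=> z zA; have [->|zy] := eqVneq z y; first by rewrite tpy tpx xy vxy.
have [->|zx] := eqVneq z x; first by rewrite tpx tpy eq_sym xy vxy.
have [|ppz pzz vpz] := pp z; first by rewrite !inE zy zx.
have pzx : p' z != x by rewrite -[X in _ != X]p'x (inj_eq perm_inj).
have pzy : p' z != y by rewrite -[X in _ != X]p'y (inj_eq perm_inj).
by rewrite !tp.
Qed.

Lemma mult_D2 A x y e : x \in A -> y \in A -> x != y -> v x = v y ->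
  mult A e = (mult (A :\ x :\ y) e + (v x == e).*2)%N.
Proof.
move=> xA yA xy vxy; rewrite /mult.
have [vxe|vxe] := eqVneq (v x) e; last first.
  rewrite addn0; apply: eq_card => z; rewrite !inE.
  have [->|_] := eqVneq z y; first by rewrite -vxy (negPf vxe) andbF.
  by have [->|//] := eqVneq z x; rewrite (negPf vxe) andbF.
rewrite (cardsD1 x) (cardsD1 y) !inE xA yA vxe -vxy vxe eqxx eq_sym xy /= !add1n addn2.
by congr _.+2; apply: eq_card => z; rewrite !inE -!andbA.
Qed.

(** Sorting the pairings by the partner of a chosen [x] gives the recursion of
[num_matchings] for the class of [x]; the other classes are unaffected. *)
Lemma card_pairing_on A :
  #|[set p | pairing_on A p]| = (\prod_(e : I) num_matchings (mult A e))%N.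
Proof.
have [k] := ubnP #|A|; elim: k A => // k IHk A ltAk.
have [->|[x xA]] := set_0Vmem A.
  rewrite big1 => [|e _]; last first.
    by rewrite /mult (_ : [set _ in _ | _] = set0) ?cards0 //; apply/setP=> z; rewrite !inE.
  apply/eqP/cards1P; exists 1; apply/setP=> p; rewrite !inE.
  apply/pairing_onP/eqP=> [[p0 _]|->]; last first.
    by split=> [|z]; rewrite ?inE // perm_on1.
  by apply/permP=> z; rewrite perm1 (out_perm p0) ?inE.
pose B := [set y in A | (v y == v x) && (y != x)].
have -> : #|[set p | pairing_on A p]| =
    (\sum_(y in B) #|[set p | pairing_on A p && (p x == y)]|)%N.
  rewrite -sum1_card (partition_big (fun p : {perm T} => p x) (mem B)) /=; last first.
    move=> p; rewrite inE => /pairing_onP[pA /(_ x xA)[_ pxx vpx]].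
    by rewrite !inE vpx eqxx pxx (perm_closed _ pA) xA.
  by apply: eq_bigr => y _; rewrite -sum1_card; apply: eq_bigl => p; rewrite !inE.
have multx : mult A (v x) = #|B|.+1.
  rewrite /mult (cardsD1 x) !inE xA eqxx add1n; congr _.+1.
  by apply: eq_card => z; rewrite !inE andbC andbA.
have [y yB|B0] := pickP (mem B); last first.
  rewrite big_pred0 // (bigD1 (v x)) //= multx.
  by rewrite (eq_card0 B0).
have in_B z : z \in B -> [/\ z \in A, x != z & v x = v z].
  by rewrite inE => /and3P[-> /eqP-> zx]; rewrite eq_sym.
have [yA xy vxy] := in_B _ yB.
have [j jE] : exists j, mult A (v x) = j.+2.
  by rewrite (mult_D2 _ xA yA xy vxy) eqxx /= addn2; eexists.
transitivity (\sum_(z in B) num_matchings j * \prod_(e | e != v x) num_matchings (mult A e))%N.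
  apply: eq_bigr => z /in_B[zA xz vxz].
  rewrite card_pairing_on_fix // IHk; last first.
    have : #|A :\ x :\ z| < #|A|.
      apply: leq_ltn_trans (subset_leq_card (subsetDl _ _)) _.
      by rewrite [X in _ < X](cardsD1 x) xA.
    by lia.
  rewrite (bigD1 (v x)) //=; congr (num_matchings _ * _)%N.
    have := mult_D2 (v x) xA zA xz vxz; rewrite jE eqxx /= addn2; by case.
  apply: eq_bigr => e ne; congr num_matchings.
  by rewrite (mult_D2 e xA zA xz vxz) eq_sym (negPf ne) addn0.
rewrite sum_nat_const [RHS](bigD1 (v x)) //= mulnA jE /=; congr (_ * _ * _)%N.
by apply/succn_inj; rewrite -multx jE.
Qed.

Lemma card_pairings :
  #|[set p | pairing p && [forall x, v (p x) == v x]]| =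
  (\prod_(e : I) num_matchings #|[set x | v x == e]|)%N.
Proof.
rewrite -[LHS](_ : #|[set p | pairing_on [set: T] p]| = _); last first.
  apply: eq_card => p; rewrite !inE; apply/pairing_onP/andP.
    case=> _ pp; split; first by apply/pairingP; split=> x; have [] := pp x (in_setT x).
    by apply/forallP=> x; have [_ _ ->] := pp x (in_setT x).
  case=> /pairingP[pK pN] /forallP pv; split=> [|x _]; first by apply/subsetP=> z; rewrite inE.
  by split=> //; apply/eqP.
rewrite card_pairing_on; apply: eq_bigr => e _; congr num_matchings.
by apply: eq_card => x; rewrite !inE.
Qed.

End CountPairings.

(** * Signed permutations *)

Lemma refines_porbits (T : finType) (I : eqType) (f : T -> I) (s : {perm T}) :
  refines (porbits s) (preim_partition f [set: T]) = [forall x, f (s x) == f x].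
Proof.
have eqR : {in [set: T] & &, equivalence_rel (fun x y => f x == f y)}.
  by split=> // /eqP->.
have pP := preim_partitionP f [set: T]; have /and3P[/eqP cP tI _] := pP.
apply/forall_inP/forallP=> [ref x|fs _ /imsetP[x _ ->]].
  have /exists_inP[C CP sC] := ref _ (imset_f (porbit s) (isT : x \in T)).
  have xC : x \in C by rewrite (subsetP sC) ?porbit_id.
  have sxC : s x \in C by rewrite (subsetP sC) // mem_porbit_step porbit_id.
  rewrite -(def_pblock tI CP sxC) in xC.
  by rewrite (pblock_equivalence_partition eqR) ?inE in xC.
have fsE y : f (s y) = f y by apply/eqP.
apply/exists_inP; exists (pblock (preim_partition f [set: T]) x).
  by apply: pblock_mem; rewrite cP inE.
apply/subsetP=> y yx; rewrite (pblock_equivalence_partition eqR) ?inE //.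
by rewrite (porbit_const fsE yx).
Qed.

Lemma refines_tilde (n : nat) (I : eqType) (l : 'I_n -> I) (s : {perm pm_ord n}) :
  refines (porbits s) (tilde (ker_part l)) = [forall x, l (s x).1 == l x.1].
Proof.
rewrite refines_porbits; apply: eq_forallb => x.
have eqR : {in [set: 'I_n] & &, equivalence_rel (fun x y => l x == l y)}.
  by split=> // /eqP->.
have /and3P[/eqP cP tI _] := preim_partitionP l [set: 'I_n].
rewrite eq_pblock ?cP ?inE //.
by rewrite (pblock_equivalence_partition eqR) ?inE.
Qed.

Section Signed.
Local Open Scope group_scope.
Variable m : nat.
Local Notation n := m.+1.
Implicit Types (a b : {perm 'I_n}) (s t : {perm pm_ord n}) (i : 'I_n) (x y : pm_ord n).
Local Notation dl := (delta n).
Local Notation gt := (gamma_tilde n).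
Local Notation rt := (ncycle m).

Lemma deltaE x : dl x = (x.1, ~~ x.2).
Proof. by rewrite permE. Qed.

Lemma deltaK : dl * dl = 1.
Proof. by apply/permP=> -[i e]; rewrite permM !deltaE perm1 /= negbK. Qed.

Lemma pairing_delta : pairing dl.
Proof.
apply/pairingP; split=> -[i e]; rewrite !deltaE ?negbK //.
by rewrite xpair_eqE eqxx /=; case: e.
Qed.

Lemma gammaE x : gamma n x = if x.2 then x else (rt x.1, false).
Proof. by rewrite permE /gamma_fun permE. Qed.

Lemma gammaVE x : (gamma n)^-1 x = if x.2 then x else (rt^-1 x.1, false).
Proof.
apply: (@perm_inj _ (gamma n)); rewrite permKV gammaE.
by case: x => i [|] //=; rewrite permKV.
Qed.

Lemma gamma_tildeE x : gt x = if x.2 then (rt^-1 x.1, true) else (rt x.1, false).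
Proof.
rewrite !permM; case: x => i [] /=; rewrite deltaE /= gammaVE /= deltaE /= gammaE /=.
  by [].
by [].
Qed.

Definition signed_fun a b x := if x.2 then (b x.1, true) else (a x.1, false).

Lemma signed_fun_inj a b : injective (signed_fun a b).
Proof. by move=> [i []] [j []] // [/perm_inj->]. Qed.

Definition signed_perm a b : {perm pm_ord n} := perm (@signed_fun_inj a b).

Lemma signed_permE a b x :
  signed_perm a b x = if x.2 then (b x.1, true) else (a x.1, false).
Proof. by rewrite permE. Qed.

Lemma signed_permM a b a' b' :
  signed_perm a b * signed_perm a' b' = signed_perm (a * a') (b * b').
Proof. by apply/permP=> -[i []]; rewrite permM !signed_permE /= permM. Qed.

Lemma signed_perm1 : signed_perm 1 1 = 1.
Proof. by apply/permP=> -[i []]; rewrite !signed_permE /= !perm1. Qed.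

Lemma signed_permV a b : (signed_perm a b)^-1 = signed_perm a^-1 b^-1.
Proof.
by apply: (mulgI (signed_perm a b)); rewrite mulgV signed_permM !mulgV signed_perm1.
Qed.

Lemma gamma_tilde_signed : gt = signed_perm rt rt^-1.
Proof. by apply/permP=> x; rewrite gamma_tildeE signed_permE. Qed.

Lemma card_porbits_signed a b :
  #|porbits (signed_perm a b)| = #|porbits a| + #|porbits b|.
Proof.
pose inj e i : pm_ord n := (i, e).
have inj_inj e : injective (inj e) by move=> i j [].
have orbE e i : porbit (signed_perm a b) (i, e) =
    inj e @: porbit (if e then b else a) i.
  have expE k : (signed_perm a b) ^+ k = signed_perm (a ^+ k) (b ^+ k).
    elim: k => [|k IHk]; first by rewrite !expg0 signed_perm1.
    by rewrite !expgS IHk signed_permM.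
  apply/setP=> y; apply/porbitP/imsetP=> [[k ->]|[_ /porbitP[k ->] ->]].
    exists (((if e then b else a) ^+ k) i); first exact: mem_porbit.
    by rewrite expE signed_permE; case: e.
  by exists k; rewrite expE signed_permE; case: e.
pose im e (D : {set 'I_n}) : {set pm_ord n} := inj e @: D.
have -> : porbits (signed_perm a b) =
    im false @: porbits a :|: im true @: porbits b.
  apply/setP=> C; rewrite inE; apply/imsetP/orP=> [[[i []] _ ->]|].
  - by right; apply/imsetP; exists (porbit b i); rewrite ?imset_f // orbE.
  - by left; apply/imsetP; exists (porbit a i); rewrite ?imset_f // orbE.
  case=> /imsetP[_ /imsetP[i _ ->] ->].
  - by exists (i, false); rewrite ?orbE.
  - by exists (i, true); rewrite ?orbE.
rewrite cardsU (_ : _ :&: _ = set0) ?cards0 ?subn0.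
  by congr (_ + _); apply: card_imset => C D; apply: imset_inj; apply: inj_inj.
apply/setP=> C; rewrite !inE; apply/negP=> /andP[].
case/imsetP=> _ /imsetP[i _ ->] -> /imsetP[_ /imsetP[j _ ->]] /=.
move/setP/(_ (i, false)); rewrite imset_f ?porbit_id // => /esym/imsetP[k _].
by case.
Qed.

Lemma sign_const (C : Type) (f : pm_ord n -> C) x :
  (forall y, f (gt y) = f y) -> f x = f (ord0, x.2).
Proof.
move=> fg; case: x => i [] /=; last first.
  apply: (ncycle_const (f := fun i => f (i, false))) => z.
  by rewrite -[RHS]fg gamma_tildeE.
apply: (ncycle_const (f := fun i => f (i, true))) => z.
by rewrite -[LHS]fg gamma_tildeE /= permK.
Qed.

(** [gamma_tilde] is transitive on the positive and on the negative numbers, and [s]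
links the two. *)
Lemma crossing_const (C : Type) (f : pm_ord n -> C) s x y :
  [exists z, (s z).2 != z.2] -> (forall z, f (s z) = f z) ->
  (forall z, f (gt z) = f z) -> f x = f y.
Proof.
case/existsP=> z sz fs fg.
have key e : f (ord0, e) = f (ord0, z.2).
  have [->//|ne] := eqVneq e z.2.
  have -> : e = (s z).2 by move: ne sz; case: e; case: (s z).2; case: z.2.
  by rewrite -(sign_const (s z) fg) fs; apply: sign_const.
by rewrite (sign_const x fg) (sign_const y fg) !key.
Qed.

(** Conversely to [crossing_const], a group generated by two permutations that keep
all signs keeps them too. *)
Lemma transitive_crossing s :
  [transitive <<[set s; gt]>>, on [set: pm_ord n] | 'P] = [exists z, (s z).2 != z.2].
Proof.
have sG : s \in <<[set s; gt]>> by rewrite mem_gen // !inE eqxx.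
have gG : gt \in <<[set s; gt]>> by rewrite mem_gen // !inE eqxx orbT.
apply/idP/idP=> [tr|cr]; last first.
  apply/imsetP; exists (ord0, false); rewrite ?inE //.
  apply/setP=> y; rewrite inE; apply/esym.
  rewrite -orbit_eq_mem; apply/eqP; apply: (crossing_const _ _ cr) => z.
    exact: orbit_act.
  exact: orbit_act.
apply/existsP; have [z sz|no] := pickP (fun z => (s z).2 != z.2); first by exists z.
have inv g x : g \in <<[set s; gt]>> -> (g x).2 = x.2.
  case/gen_prodgP=> k [c cP ->]; elim: k c cP x => [|k IHk] c cP x.
    by rewrite big_ord0 perm1.
  rewrite big_ord_recl permM IHk => [|i]; last exact: cP.
  have := cP ord0; rewrite !inE => /orP[]/eqP->; last by rewrite gamma_tildeE; case: x => i [].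
  by apply/eqP/negbFE/no.
have := atransP2 tr (in_setT (ord0, false)) (in_setT (ord0, true)).
by case=> g /(inv _ (ord0, false)) gE /(congr1 snd) /=; rewrite gE.
Qed.

(** An invariant function is constant, and [gamma_tilde] has two cycles. *)
Lemma crossing_genus s : [exists z, (s z).2 != z.2] ->
  #|porbits s| + #|porbits (gt * s^-1)| <= 2 * n.
Proof.
move=> cr; have [f [fk fs]] := genus_bound (gt * s^-1) s.
have fg z : f (gt z) = f z by rewrite -[gt](mulgKV s) permM fs fk.
rewrite mulgKV gamma_tilde_signed card_porbits_signed porbitsV !porbits_ncycle.
rewrite card_prod card_ord card_bool => le_f.
have im_f : f @: [set: pm_ord n] \subset [set f (ord0, false)].
  apply/subsetP=> _ /imsetP[i _ ->]; rewrite inE; apply/eqP.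
  exact: crossing_const cr fs fg.
have := subset_leq_card im_f; rewrite cards1.
have arith A B F : B + A + (1 + 1) <= n * 2 + F.*2 -> F <= 1 -> A + B <= 2 * n by lia.
exact/arith/le_f.
Qed.

Lemma signed_no_crossing a b : [exists z, (signed_perm a b z).2 != z.2] = false.
Proof. by apply/existsP=> -[[i []]]; rewrite signed_permE. Qed.

Lemma pairing_signed a : pairing (dl * signed_perm a a^-1).
Proof.
apply/pairingP; split=> -[i []]; rewrite !permM !deltaE !signed_permE /= ?permK ?permKV //.
  by rewrite xpair_eqE andbF.
by rewrite xpair_eqE andbF.
Qed.

(** [delta * s] is an involution, so that [s] acts on the negative numbers inversely
to its action on the positive ones. *)
Lemma no_crossing_signed s : pairing (dl * s) -> ~~ [exists z, (s z).2 != z.2] ->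
  exists a, s = signed_perm a a^-1.
Proof.
move=> /pairingP[sK _]; rewrite negb_exists => /forallP cr.
have sg z : (s z).2 = z.2 by apply/eqP/negPn/cr.
have a_inj : injective (fun i => (s (i, false)).1).
  move=> i j ij; have : s (i, false) = s (j, false).
    by rewrite (surjective_pairing (s (i, _))) (surjective_pairing (s (j, _))) ij !sg.
  by move/perm_inj => [].
exists (perm a_inj); apply/permP=> -[i []]; rewrite signed_permE /=; last first.
  by rewrite permE [LHS]surjective_pairing sg.
have := sK (i, false); rewrite !permM !deltaE /= sg /=.
rewrite [s (i, true)]surjective_pairing sg /=; set j := (s (i, true)).1.
move=> sj; congr (_, _); apply: (@perm_inj _ (perm a_inj)).
by rewrite permKV permE sj.
Qed.

Lemma signed_perm_inj : injective (fun a => signed_perm a a^-1).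
Proof.
move=> a b /permP ab; apply/permP=> i; have := ab (i, false).
by rewrite !signed_permE => -[].
Qed.

Lemma card_porbits_signed_krew a :
  #|porbits (gt * (signed_perm a a^-1)^-1)| = (#|porbits (krew a)|).*2.
Proof.
rewrite gamma_tilde_signed signed_permV signed_permM card_porbits_signed -addnn.
congr (_ + _); rewrite invgK -porbitsV invMg invgK porbits_mulC.
by [].
Qed.

(** The product of [krew a] and [a] is the full cycle; compare the signatures. *)
Lemma krew_parity a : odd (#|porbits a| + #|porbits (krew a)|) = odd n.+1.
Proof.
have := congr1 (@odd_perm _) (mulgKV a rt).
rewrite odd_permM /odd_perm porbits_ncycle card_ord oddD /= addbT.
by case: (odd m) (odd #|porbits a|) (odd #|porbits (krew a)|) => [] [] [].
Qed.

(** The permutations that do not connect the two cycles of [gamma_tilde] come from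
permutations of the [n] indices, with all cycle counts doubled. *)
Lemma sum_pairings (V : nmodType) (I : eqType) (l : 'I_n -> I) (W : nat -> nat -> V) :
  (\sum_(s | is_pairing (dl * s) && refines (porbits s) (tilde (ker_part l)))
      W #|porbits s| #|porbits (gt * s^-1)|
   = \sum_(a | refines (porbits a) (ker_part l))
       W (#|porbits a|).*2 (#|porbits (krew a)|).*2
   + \sum_(s | [&& is_pairing (dl * s), refines (porbits s) (tilde (ker_part l))
                & [transitive <<[set s; gt]>>, on [set: pm_ord n] | 'P]])
       W #|porbits s| #|porbits (gt * s^-1)|)%R.
Proof.
rewrite (bigID (fun s => [exists z, (s z).2 != z.2])) /= GRing.addrC; congr (_ + _)%R.
  rewrite (eq_bigl (mem ((fun a => signed_perm a a^-1) @:
      [set a | refines (porbits a) (ker_part l)]))) /=.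
    rewrite big_imset /=; last by move=> a b _ _; apply: signed_perm_inj.
    rewrite (eq_bigl (fun a => refines (porbits a) (ker_part l))); last first.
      by move=> a; rewrite inE.
    apply: eq_bigr => a _; rewrite card_porbits_signed_krew.
    by rewrite card_porbits_signed porbitsV addnn.
  move=> s; rewrite /is_pairing -pairing_card_porbits refines_tilde.
  apply/andP/imsetP=> [[/andP[ps /forallP ls] cr]|[a]].
    have [a sE] := no_crossing_signed ps cr; exists a => //.
    rewrite inE refines_porbits; apply/forallP=> i.
    by have := ls (i, false); rewrite sE signed_permE.
  rewrite inE refines_porbits => /forallP la ->.
  rewrite pairing_signed signed_no_crossing; split=> //; apply/forallP=> -[i []].
    by rewrite signed_permE /= -{2}[i](permKV a) eq_sym la.
  by rewrite signed_permE /= la.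
by apply: eq_bigl => s; rewrite transitive_crossing andbA.
Qed.

End Signed.

(** * Index sums in Wick's formula *)

Lemma sum_bool_card (T : finType) (P : pred T) : (\sum_x P x)%N = #|[set x | P x]|.
Proof.
by rewrite -sum1_card big_mkcond [RHS]big_mkcond; apply: eq_bigr => x _; rewrite inE; case: P.
Qed.

Section WickCount.
Local Open Scope group_scope.
Variables (m N K : nat) (I : finType) (l : 'I_m.+1 -> I).
Local Notation n := m.+1.
Local Notation dl := (delta n).
Local Notation gt := (gamma_tilde n).
Implicit Types (a : {ffun 'I_n -> 'I_N}) (j : {ffun 'I_n -> 'I_K}) (p s : {perm pm_ord n}).

(** The two factors of the [k]-th matrix are entries of the rows [a k] and [a (k + 1)],
cyclically, and of the column [j k]. *)
Definition row_index a (x : pm_ord n) := if x.2 then a (ordS x.1) else a x.1.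

Definition half_edge a j (x : pm_ord n) := (l x.1, (row_index a x, j x.1)).

Lemma pairing_rows : pairing (dl * gt).
Proof. by rewrite gamma_tilde_signed pairing_signed. Qed.

Lemma ncycleES i : ncycle m i = ordS i.
Proof. by rewrite permE. Qed.

Lemma row_indexP a x : row_index a ((dl * gt) x) = row_index a x.
Proof.
rewrite /row_index permM deltaE gamma_tildeE; case: x => i [] /=.
  by rewrite permE.
by rewrite -ncycleES permKV.
Qed.

(** The functions [row_index a] are the functions invariant under the pairing
[delta * gamma_tilde]. *)
Lemma card_rows p : pairing p ->
  #|[set a | [forall x, row_index a (p x) == row_index a x]]|
    = (N ^ #|porbits (dl * gt * p)|./2)%N.
Proof.
move=> pp; rewrite -(card_invariant pairing_rows pp).
pose F a : {ffun pm_ord n -> 'I_N} := [ffun x => row_index a x].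
have Finj : injective F.
  move=> a b /ffunP ab; apply/ffunP=> i; have := ab (i, false).
  by rewrite !ffunE.
rewrite -(card_imset _ Finj); apply: eq_card => h; rewrite inE.
apply/imsetP/forallP=> [[a]|hP].
  rewrite inE => /forallP ap -> x; rewrite !ffunE row_indexP eqxx.
  exact: ap.
have hF : h = F [ffun i => h (i, false)].
  apply/ffunP=> -[i []]; rewrite !ffunE /row_index /= ffunE //.
  have /andP[/eqP<- _] := hP (i, true); congr (h _).
  by rewrite permM deltaE gamma_tildeE /= permE.
exists [ffun i => h (i, false)] => //; rewrite inE; apply/forallP=> x.
have /andP[_] := hP x; rewrite {1 2}hF !ffunE; exact.
Qed.

(** A function of the absolute value is a function invariant under [delta]. *)
Lemma card_cols p : pairing p ->
  #|[set j : {ffun 'I_n -> 'I_K} | [forall x, j (p x).1 == j x.1]]|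
    = (K ^ #|porbits (dl * p)|./2)%N.
Proof.
move=> pp; rewrite -(card_invariant (pairing_delta m) pp).
pose F j : {ffun pm_ord n -> 'I_K} := [ffun x : pm_ord n => j x.1].
have Finj : injective F.
  move=> a b /ffunP ab; apply/ffunP=> i; have := ab (i, false).
  by rewrite !ffunE.
rewrite -(card_imset _ Finj); apply: eq_card => h; rewrite inE.
apply/imsetP/forallP=> [[a]|hP].
  rewrite inE => /forallP ap -> x; rewrite !ffunE deltaE eqxx.
  exact: ap.
have hF : h = F [ffun i => h (i, false)].
  apply/ffunP=> -[i []]; rewrite !ffunE //=.
  by have /andP[/eqP<- _] := hP (i, true); rewrite deltaE.
exists [ffun i => h (i, false)] => //; rewrite inE; apply/forallP=> x.
have /andP[_] := hP x; rewrite {1 2}hF !ffunE; exact.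
Qed.

(** [delta * s] is an involution, so that [s^-1 * delta] equals [delta * s]; the two
products are then conjugate. *)
Lemma card_row_cycles s : pairing (dl * s) ->
  #|porbits (gt * s^-1)| = #|porbits (dl * gt * (dl * s))|.
Proof.
case/pairingP=> ppK _.
have -> : dl * s = s^-1 * dl.
  have dlV : dl^-1 = dl by apply/eqP; rewrite eq_invg_mul deltaK.
  rewrite -{2}dlV -invMg; apply/eqP; rewrite eq_sym eq_invg_mul; apply/eqP/permP=> x.
  by rewrite permM ppK perm1.
rewrite [RHS]porbits_mulC -[_ * _ * (_ * _)]mulgA [dl * (dl * _)]mulgA deltaK mul1g.
exact: porbits_mulC.
Qed.

Lemma even_cycles s : pairing (dl * s) ->
  ~~ odd #|porbits s| /\ ~~ odd #|porbits (gt * s^-1)|.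
Proof.
move=> ps; rewrite card_row_cycles // (card_porbits_pairings pairing_rows ps).
have := card_porbits_pairings (pairing_delta m) ps.
by rewrite mulgA deltaK mul1g => ->; rewrite !odd_double.
Qed.

(** The pairing [p = delta * s] matches the [2 * n] Gaussian factors of the
trace.  It contributes one free row index per orbit of the group generated by
[p] and the pairing [delta * gamma_tilde] of the factors that share a row index,
and one free column index per orbit of the group generated by [p] and
[delta]. *)
Lemma wick_count :
  (\sum_a \sum_j \prod_(e : I * ('I_N * 'I_K)) num_matchings #|[set x | half_edge a j x == e]|)%N
  = (\sum_(s | is_pairing (dl * s) && refines (porbits s) (tilde (ker_part l)))
      N ^ #|porbits (gt * s^-1)|./2 * K ^ #|porbits s|./2)%N.
Proof.
have dlK s : dl * (dl * s) = s by rewrite mulgA deltaK mul1g.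
pose L p := [forall x, l (p x).1 == l x.1].
pose A p a := [forall x, row_index a (p x) == row_index a x].
pose B p j := [forall x, j (p x).1 == j x.1].
transitivity (\sum_(a : {ffun 'I_n -> 'I_N}) \sum_(j : {ffun 'I_n -> 'I_K})
    \sum_(p : {perm pm_ord n} | pairing p && L p) (A p a * B p j)%N)%N.
  apply: eq_bigr => a _; apply: eq_bigr => j _.
  rewrite -(card_pairings (half_edge a j)) -sum1_card big_mkcond [RHS]big_mkcond /=.
  apply: eq_bigr => p _; rewrite inE.
  have -> : [forall x, half_edge a j (p x) == half_edge a j x] = [&& L p, A p a & B p j].
    apply/forallP/and3P=> [H|[/forallP Lp /forallP Ap /forallP Bp] x].
      by split; apply/forallP=> x; have := H x; rewrite !xpair_eqE => /and3P[].
    by rewrite /half_edge !xpair_eqE Lp Ap Bp.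
  by case: (pairing p); case: (L p); case: (A p a); case: (B p j).
rewrite (eq_bigr (fun a => \sum_(p | pairing p && L p) \sum_j A p a * B p j)%N) => [|a _].
  rewrite exchange_big /= (reindex_inj (mulgI dl)) /=; apply: eq_big => [s|s ps].
    rewrite /is_pairing -pairing_card_porbits refines_tilde; congr (_ && _).
    apply/forallP/forallP=> H x.
      by have := H (dl x); rewrite permM !deltaE /= negbK -surjective_pairing.
    by rewrite permM (eqP (H _)) deltaE.
  have /andP[pp _] := ps.
  rewrite (eq_bigr (fun a => A (dl * s)%g a * \sum_j B (dl * s)%g j)%N) => [|a _]; last first.
    by rewrite big_distrr.
  rewrite -big_distrl /= !sum_bool_card card_rows // card_cols // dlK.
  by rewrite card_row_cycles.
by rewrite exchange_big.
Qed.

End WickCount.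

Import GRing.Theory.

(** * Traces and products as sums over index functions *)

Section TraceProduct.
Local Open Scope ring_scope.
Variables (R : comNzRingType) (N : nat).

Definition snoc (T : Type) m (f : {ffun 'I_m -> T}) (x : T) : {ffun 'I_m.+1 -> T} :=
  [ffun i => if unlift ord_max i is Some j then f j else x].

Lemma snoc_last (T : Type) m (f : {ffun 'I_m -> T}) x i :
  i = m :> nat -> snoc f x (inord i) = x.
Proof.
move=> ->; have -> : inord m = ord_max :> 'I_m.+1 by apply/val_inj; rewrite /= inordK.
by rewrite ffunE unlift_none.
Qed.

Lemma snoc_init (T : Type) m (f : {ffun 'I_m.+1 -> T}) x (i : nat) :
  (i <= m)%N -> snoc f x (inord i) = f (inord i).
Proof.
move=> im; rewrite ffunE.
have -> : inord i = lift ord_max (inord i : 'I_m.+1) :> 'I_m.+2.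
  apply/val_inj; rewrite /= /bump !inordK ?ltnS ?(leq_trans im) //.
  by rewrite leqNgt ltnS im.
by rewrite liftK.
Qed.

Lemma sum_snoc (V : nmodType) (T : finType) m (F : {ffun 'I_m.+1 -> T} -> V) :
  \sum_f F f = \sum_(f : {ffun 'I_m -> T}) \sum_x F (snoc f x).
Proof.
rewrite pair_big /=.
apply: (reindex (fun p : {ffun 'I_m -> T} * T => snoc p.1 p.2)).
apply: onW_bij; exists (fun f : {ffun 'I_m.+1 -> T} =>
  ([ffun i : 'I_m => f (lift ord_max i)] : {ffun 'I_m -> T}, f ord_max)) => [[f x]|f] /=.
  congr (_, _); last by rewrite ffunE unlift_none.
  by apply/ffunP=> i; rewrite !ffunE liftK.
apply/ffunP=> i; rewrite ffunE; case: unliftP => [j ->|->] //.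
by rewrite ffunE.
Qed.

(** [B] closes the chain; the sum over the last index multiplies the last of the
[A k] into it, which is the induction step. *)
Lemma trace_chain m (A : nat -> 'M[R]_N) (B : 'M[R]_N) :
  \sum_(a : {ffun 'I_m.+1 -> 'I_N})
    (\prod_(k < m) A k (a (inord k)) (a (inord k.+1))) * B (a (inord m)) (a (inord 0))
  = \tr ((\prod_(k < m) A k) *m B).
Proof.
elim: m B => [|m IHm] B.
  rewrite big_ord0 mul1mx sum_snoc exchange_big /=; apply: eq_bigr => x _.
  rewrite (big_pred1 [ffun=> x]) => [|f]; last first.
    by apply/esym/eqP/ffunP=> -[].
  by rewrite big_ord0 mul1r !(snoc_last _ _ (erefl 0%N)).
rewrite sum_snoc big_ord_recr /= -mulmxA -IHm; apply: eq_bigr => a _.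
rewrite !mxE big_distrr /=; apply: eq_bigr => x _.
rewrite big_ord_recr /= (snoc_init a x (leqnn m)) (snoc_init a x (leq0n m)).
rewrite (snoc_last a x (erefl m.+1)) mulrA; congr (_ * _ * _).
apply: eq_bigr => k _.
by rewrite (snoc_init a x (ltnW (ltn_ord k))) (snoc_init a x (ltn_ord k)).
Qed.

Lemma trace_prod m (A : 'I_m.+1 -> 'M[R]_N) :
  \tr (\prod_k A k) = \sum_(a : {ffun 'I_m.+1 -> 'I_N}) \prod_k A k (a k) (a (ordS k)).
Proof.
have AE k : A k = A (inord k) by rewrite inord_val.
under eq_bigr do rewrite AE.
rewrite big_ord_recr /= -[LHS](trace_chain m (fun k => A (inord k)) (A (inord m))).
apply: eq_bigr => a _.
rewrite big_ord_recr /=; congr (_ * _).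
  apply: eq_bigr => k _; have lt_k := ltn_ord k.
  have -> : inord k = widen_ord (leqnSn m) k by apply/val_inj; rewrite /= inordK // ltnW.
  congr (A _ (a _) (a _)); apply/val_inj; rewrite /= inordK ?ltnS //.
  by rewrite modn_small // ltnS.
have -> : inord m = ord_max :> 'I_m.+1 by apply/val_inj; rewrite /= inordK.
congr (A _ (a _) (a _)); apply/val_inj; rewrite /= inordK //.
by rewrite modnn.
Qed.

End TraceProduct.

(** A product over the colours of sums over the functions on one fibre of [l]
is a sum over functions on the whole domain, as these are glued from their
restrictions to the fibres.  A function on a fibre is coded by its extension by
the default value [j0]. *)
Lemma sum_prod_fibers (R : comNzRingType) (D I J : finType) (l : D -> I) (j0 : J)
    (H : I -> {ffun D -> J} -> R) :
  (forall i (f f' : {ffun D -> J}), (forall k, l k = i -> f k = f' k) -> H i f = H i f') ->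
  (\prod_i \sum_(f in pffun_on j0 [pred k | l k == i] predT) H i f
    = \sum_f \prod_i H i f)%R.
Proof.
move=> Hloc; rewrite (bigA_distr_big_dep (fun i f => f \in pffun_on j0 [pred k | l k == i] predT)).
pose h (f : {ffun D -> J}) : {ffun I -> {ffun D -> J}} :=
  [ffun i => [ffun k => if l k == i then f k else j0]].
pose h' (F : {ffun I -> {ffun D -> J}}) : {ffun D -> J} := [ffun k => F (l k) k].
rewrite (reindex_onto h h') => [|F /familyP FP]; last first.
  apply/ffunP=> i; apply/ffunP=> k; rewrite !ffunE; case: eqP => [->//|/eqP lk].
  have /pffun_onP[/supportP -> //] := FP i.
apply: eq_big => [f|f _]; last first.
  by apply: eq_bigr => i _; apply: Hloc => k <-; rewrite !ffunE eqxx.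
apply/andP; split; last by apply/eqP/ffunP=> k; rewrite !ffunE eqxx.
apply/familyP=> i; apply/pffun_onP; split=> //.
by apply/supportP=> k; rewrite !ffunE inE => /negPf->.
Qed.

From mathcomp Require Import all_classical all_reals all_analysis.
From mathcomp Require Import measurable_realfun ring lra.

Import Order.TTheory GRing.Theory Num.Theory.
Import numFieldNormedType.Exports.
Local Open Scope classical_set_scope.
Local Open Scope ring_scope.

(** * Moments of the normal law *)

Section NormalMoments.
Variable R : realType.
Notation mu := (@lebesgue_measure R).
Notation nu := (@normal_prob R 0 1).
Notation phi := (@normal_pdf R 0 1).
Implicit Types (x : R) (k : nat).

Lemma normal_pdf01E x : phi x = normal_peak 1 * expR (- x ^+ 2 / 2).
Proof.
by rewrite normal_pdfE ?oner_eq0 // /normal_fun subr0 expr1n.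
Qed.

Lemma normal_pdf02E x : normal_pdf 0 2 x = normal_peak 2 * expR (- x ^+ 2 / 8).
Proof.
rewrite normal_pdfE // /normal_fun subr0; congr (_ * expR (_ / _)).
by rewrite -mulr_natr expr2; ring.
Qed.

Lemma is_derive_normal_pdf x : is_derive x 1 phi (- x * phi x).
Proof.
have -> : phi = (fun x => normal_peak 1 * expR (- x ^+ 2 / 2)).
  by apply/funext => y; rewrite normal_pdf01E.
apply: is_derive_eq.
by rewrite /GRing.scale /=; field.
Qed.

(** Gaussian decay absorbs any power: [|x| ^+ k <= k! * e ^ |x|], and completing the
square leaves a multiple of a wider Gaussian density. *)
Lemma normal_pdf_decay k : exists2 K, 0 <= K &
  forall x, `|x| ^+ k * phi x <= K * normal_pdf 0 2 x.
Proof.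
have p2 : 0 < normal_peak 2 :> R by rewrite normal_peak_gt0.
exists (k`!%:R * expR 1 * normal_peak 1 / normal_peak 2).
  by rewrite !mulr_ge0 ?invr_ge0 ?expR_ge0 ?normal_peak_ge0.
move=> x; rewrite normal_pdf01E normal_pdf02E.
rewrite [leRHS](_ : _ = normal_peak 1 * (k`!%:R * (expR 1 * expR (- x ^+ 2 / 8)))); last first.
  by field; rewrite gt_eqF.
rewrite mulrCA ler_wpM2l ?normal_peak_ge0 //.
have pow_le : `|x| ^+ k <= k`!%:R * expR `|x|.
  case: k => [|k]; first by rewrite expr0 fact0 mul1r -[leLHS]expR0 ler_expR.
  have := expR_ge1Dxn k (normr_ge0 x).
  rewrite -ler_pdivrMl ?ltr0n ?fact_gt0 // mulrC => h.
  by apply: le_trans h; rewrite lerDr.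
apply: le_trans (ler_wpM2r (expR_ge0 _) pow_le) _.
rewrite -mulrA ler_wpM2l // -!expRD ler_expR.
have := sqr_ge0 (`|x| - 2); rewrite -(real_normK (num_real x)).
by nra.
Qed.

Lemma integrable_monomial k :
  mu.-integrable setT (EFin \o (fun x => x ^+ k * phi x)).
Proof.
have [K K0 le_K] := normal_pdf_decay k.
apply: (@le_integrable _ _ _ mu _ _ _ (EFin \o (fun x => K * normal_pdf 0 2 x))) => //.
- apply/measurable_EFinP; apply: measurable_funM; first exact: exprn_measurable.
  exact: measurable_normal_pdf.
- move=> x _ /=; rewrite lee_fin normrM normrX (ger0_norm (normal_pdf_ge0 _ _ _)).
  rewrite [leRHS]ger0_norm ?le_K // mulr_ge0 ?normal_pdf_ge0 //.
- rewrite (_ : EFin \o _ = (fun x => K%:E * (normal_pdf 0 2 x)%:E)%E) //.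
  by apply: integrableZl => //; exact: integrable_normal_pdf.
Qed.


(** [phi] agrees almost everywhere with the Radon-Nikodym derivative. *)
Lemma ge0_integral_normal_prob (f : R -> \bar R) : (forall x, 0 <= f x)%E ->
  measurable_fun setT f ->
  (\int[nu]_x f x = \int[mu]_x (f x * (phi x)%:E))%E.
Proof.
move=> f0 mf; have dom := normal_prob_dominates 0 1 : nu `<< mu.
rewrite -(Radon_Nikodym_SigmaFinite.change_of_variables dom f0 measurableT mf).
have mphi : measurable_fun setT (EFin \o phi).
  by apply/measurable_EFinP; exact: measurable_normal_pdf.
have iRN := Radon_Nikodym_SigmaFinite.f_integrable dom.
apply: ae_eq_integral => //.
- apply: emeasurable_funM => //; exact: measurable_int iRN.
- exact: emeasurable_funM.
- apply: ae_eqe_mul2l; apply: integral_ae_eq => //.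
  move=> E _ mE; rewrite -Radon_Nikodym_SigmaFinite.f_integral //.
Qed.

Lemma integral_itv_growing (f : R -> R) : mu.-integrable setT (EFin \o f) ->
  (fun n : nat => \int[mu]_(x in `[(- n.+1%:R)%R, n.+1%:R%R]) (f x)%:E)%E @ \oo
    --> (\int[mu]_x (f x)%:E)%E.
Proof.
move=> intf.
have mf := measurable_int _ intf.
pose g (n : nat) x := ((f \_ `[- n.+1%:R, n.+1%:R]%classic) x)%:E.
have gE n : (\int[mu]_(x in `[(- n.+1%:R)%R, n.+1%:R%R]) (f x)%:E = \int[mu]_x (g n x))%E.
  rewrite integral_mkcond; apply: eq_integral => x _.
  by rewrite /g !patchE; case: ifP.
under eq_fun do rewrite gE.
have [] // := @dominated_convergence _ _ _ mu setT measurableT g (EFin \o f) (abse \o (EFin \o f)).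
- move=> n; apply/measurable_EFinP.
  apply/(measurable_restrictT _ _).1 => //; apply: measurable_funTS.
  exact/measurable_EFinP.
- apply: aeW => x _; apply: cvg_near_cst; near=> n.
  rewrite /g patchE mem_set //= in_itv /= -ler_norml.
  rewrite (le_trans (ltW (Num.Theory.truncnS_gt _))) // ler_nat ltnS.
  near: n; exact: nbhs_infty_ge.
- exact: integrable_abse.
- apply: aeW => x n _ /=; rewrite /g patchE; case: ifP => //= _.
  by rewrite normr0 lee_fin.
Unshelve. all: by end_near. Qed.



Let F k x := x ^+ k * phi x.

Lemma monomial_pdf_tail k (e : R) : `|e| = 1 ->
  (fun n : nat => F k (e * n.+1%:R)) @ \oo --> 0.
Proof.
move=> e1; have [K K0 le_K] := normal_pdf_decay k.+1.
apply/norm_cvg0P.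
have bnd (n : nat) : `|F k (e * n.+1%:R)| <= K * normal_peak 2 * n.+1%:R^-1.
  have := le_K (e * n.+1%:R).
  rewrite normrM e1 mul1r (ger0_norm (ler0n _ _)) => le1.
  rewrite /F normrM normrX normrM e1 mul1r (ger0_norm (ler0n _ _)).
  rewrite (ger0_norm (normal_pdf_ge0 _ _ _)) ler_pdivlMr ?ltr0n // mulrAC -exprSr.
  by apply: le_trans le1 _; rewrite ler_wpM2l // normal_pdf_ub.
apply: (squeeze_cvgr (f := fun=> 0) (h := fun n : nat => K * normal_peak 2 * n.+1%:R^-1)).
- by apply: nearW => n; rewrite bnd normr_ge0.
- exact: cvg_cst.
- rewrite -[X in _ --> X](mulr0 (K * normal_peak 2)).
  by apply: cvgM; [exact: cvg_cst | exact: cvg_harmonic].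
Qed.

Lemma is_derive_monomial_pdf k x :
  is_derive x 1 (F k) (k%:R * F k.-1 x - F k.+1 x).
Proof.
have dphi := is_derive_normal_pdf x.
have dX : is_derive x 1 (fun y : R => y ^+ k) (k%:R * x ^+ k.-1).
  rewrite (_ : (fun y : R => y ^+ k) = (@id R) ^+ k); last by rewrite fctE.
  by apply: is_derive_eq; rewrite /GRing.scale /= mulr1.
have h := is_deriveM dX dphi.
apply: (is_derive_eq h); rewrite /F /GRing.scale /= exprS.
case: k {h dX} => [|k] /=; rewrite ?expr0; ring.
Qed.

Lemma continuous_monomial_pdf k : continuous (F k).
Proof.
move=> x; apply/differentiable_continuous/derivable1_diffP.
by have [] := is_derive_monomial_pdf k x.
Qed.

(** The integrand is the derivative of [x ^+ k * phi x], which tends to zero at both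
ends. *)
Lemma integral_monomial_rec k :
  (\int[mu]_x (k%:R * F k.-1 x - F k.+1 x)%:E = 0)%E.
Proof.
set f := fun x => k%:R * F k.-1 x - F k.+1 x.
have cf : continuous f.
  move=> x; apply: cvgB; last exact: continuous_monomial_pdf.
  by apply: cvgM; [exact: cvg_cst | exact: continuous_monomial_pdf].
have intf : mu.-integrable setT (EFin \o f).
  rewrite (_ : EFin \o f = (fun x => k%:R%:E * (F k.-1 x)%:E - (F k.+1 x)%:E)%E) //.
  apply: integrableB => //; last exact: integrable_monomial.
  by apply: integrableZl => //; exact: integrable_monomial.
have lim1 := integral_itv_growing intf.
have lim2 : (fun n : nat => \int[mu]_(x in `[(- n.+1%:R)%R, n.+1%:R%R]) (f x)%:E)%E @ \oo --> 0%:E.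
  have E n : (\int[mu]_(x in `[(- n.+1%:R)%R, n.+1%:R%R]) (f x)%:E)%E
      = (F k (1 * n.+1%:R) - F k (-1 * n.+1%:R))%:E.
    rewrite (@continuous_FTC2 R f (F k)) ?mul1r ?mulN1r ?EFinB //.
    - by rewrite gtrN.
    - exact: continuous_subspaceT.
    - split=> [x _||].
      + by have [] := is_derive_monomial_pdf k x.
      + exact/cvg_at_right_filter/continuous_monomial_pdf.
      + exact/cvg_at_left_filter/continuous_monomial_pdf.
    - move=> x _; rewrite derive1E.
      by have [_ ->] := is_derive_monomial_pdf k x.
  under eq_fun do rewrite E.
  apply: cvg_EFin; first by apply: nearW.
  rewrite -[X in _ --> X](subrr 0).
  apply: cvgB; apply: monomial_pdf_tail; by rewrite ?normrN normr1.
exact: (cvg_unique _ lim1 lim2).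
Qed.

Lemma integral_monomial_pdf k : (\int[mu]_x (F k x)%:E = (num_matchings k)%:R%:E)%E.
Proof.
have fin k0 : (\int[mu]_x (F k0 x)%:E)%E \is a fin_num.
  by apply: integrable_fin_num => //; exact: integrable_monomial.
have rec k0 : (\int[mu]_x (F k0.+1 x)%:E = k0%:R%:E * \int[mu]_x (F k0.-1 x)%:E)%E.
  have := integral_monomial_rec k0.
  under eq_integral do rewrite EFinB EFinM.
  rewrite integralB //=; last 2 first.
  - by apply: integrableZl => //; exact: integrable_monomial.
  - exact: integrable_monomial.
  rewrite integralZl //=; last exact: integrable_monomial.
  rewrite -(fineK (fin k0.-1)) -(fineK (fin k0.+1)) -EFinM -EFinB => -[/eqP].
  by rewrite subr_eq0 => /eqP->.
have [m] := ubnP k; elim: m k => // m IHm [|[|k]] ltk.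
- by under eq_integral do rewrite /F expr0 mul1r; rewrite integral_normal_pdf.
- by rewrite rec mul0e.
- by rewrite rec /= IHm -?EFinM ?natrM // ltnW.
Qed.

Lemma normal_moment k :
  nu.-integrable setT (EFin \o (fun x => x ^+ k)) /\
  (\int[nu]_x (x ^+ k)%:E = (num_matchings k)%:R%:E)%E.
Proof.
have mk : measurable_fun setT (EFin \o (fun x : R => x ^+ k)).
  by apply/measurable_EFinP; exact: exprn_measurable.
have intk : nu.-integrable setT (EFin \o (fun x => x ^+ k)).
  apply/integrableP; split => //.
  rewrite ge0_integral_normal_prob //; last exact: measurableT_comp.
  have /integrableP[_] := integrable_monomial k.
  apply: le_lt_trans; rewrite le_eqVlt; apply/orP; left; apply/eqP.
  apply: eq_integral => x _ /=.
  by rewrite normrM (ger0_norm (normal_pdf_ge0 _ _ _)) EFinM.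
split => //; rewrite -integral_monomial_pdf.
rewrite [in LHS]integralE ge0_integral_normal_prob //; last first.
  exact: measurable_funepos.
rewrite ge0_integral_normal_prob //; last exact: measurable_funeneg.
rewrite [RHS]integralE; congr (_ - _)%E; apply: eq_integral => x _.
- rewrite !funeposE /= /F -!EFin_max -EFinM; congr EFin.
  by rewrite maxr_pMl ?mul0r ?normal_pdf_ge0.
- rewrite !funenegE /= /F -?EFinN -!EFin_max -EFinM; congr EFin.
  by rewrite maxr_pMl ?mul0r ?mulNr ?normal_pdf_ge0.
Qed.

End NormalMoments.

(** * Random variables with moments of all orders *)

Section AllMoments.
Context (d : measure_display) (T : measurableType d) (R : realType) (P : probability T R).
Implicit Types (X Y W : T -> R).

(** A class of integrable variables that is closed under sums and products. *)
Definition all_moments X := measurable_fun setT X /\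
  forall k, P.-integrable setT (EFin \o (fun w => X w ^+ k)).

Lemma all_moments_integrable X : all_moments X -> P.-integrable setT (EFin \o X).
Proof. by case=> _ /(_ 1%N); congr (_.-integrable _ _); apply/funext => w /=; rewrite expr1. Qed.

(** Because [|x y|] is at most [x ^+ 2 + y ^+ 2]. *)
Lemma integrable_mul_moments X Y i j : all_moments X -> all_moments Y ->
  P.-integrable setT (EFin \o (fun w => X w ^+ i * Y w ^+ j)).
Proof.
move=> [mX iX] [mY iY].
apply: (@le_integrable _ _ _ P _ measurableT _
  ((EFin \o (fun w => X w ^+ (i + i))%R) \+ (EFin \o (fun w => Y w ^+ (j + j))%R))%E).
- apply/measurable_EFinP; apply: measurable_funM; exact: measurable_funX.
- move=> w _ /=; rewrite lee_fin !exprD -!expr2 normrM.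
  rewrite [leRHS]ger0_norm ?addr_ge0 ?sqr_ge0 //.
  have := sqr_ge0 (`|X w ^+ i| - `|Y w ^+ j|).
  rewrite -(real_normK (num_real (X w ^+ i))) -(real_normK (num_real (Y w ^+ j))).
  have := normr_ge0 (X w ^+ i); have := normr_ge0 (Y w ^+ j).
  by nra.
- exact: integrableD.
Qed.

Lemma all_moments_mul X Y : all_moments X -> all_moments Y ->
  all_moments (fun w => X w * Y w).
Proof.
move=> aX aY; split; first by apply: measurable_funM; [case: aX|case: aY].
move=> k; have := integrable_mul_moments k k aX aY; congr (_.-integrable _ _).
by apply/funext => w /=; rewrite exprMn.
Qed.

Lemma all_moments_add X Y : all_moments X -> all_moments Y ->
  all_moments (fun w => X w + Y w).
Proof.
move=> aX aY; split; first by apply: measurable_funD; [case: aX|case: aY].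
move=> k; rewrite (_ : EFin \o _ = fun w =>
  (\sum_(i < k.+1) (X w ^+ (k - i) * Y w ^+ i *+ 'C(k, i))%R%:E)%E).
  apply: integrable_sum => // i _.
  rewrite (_ : (fun w => _) = fun w => ('C(k, i)%:R%:E * (X w ^+ (k - i) * Y w ^+ i)%R%:E)%E).
    by apply: integrableZl => //; exact: integrable_mul_moments.
  by apply/funext => w; rewrite -EFinM mulr_natl.
by apply/funext => w /=; rewrite exprDn sumEFin.
Qed.

Lemma all_moments_bounded X (C : R) : measurable_fun setT X ->
  (forall w, `|X w| <= C) -> all_moments X.
Proof.
move=> mX XC; split=> // k.
apply: (@le_integrable _ _ _ P _ measurableT _ (EFin \o cst (C ^+ k))).
- apply/measurable_EFinP; exact: measurable_funX.
- move=> w _ /=; rewrite lee_fin normrX.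
  have C0 : 0 <= C by apply: le_trans (XC w).
  by rewrite [leRHS]ger0_norm ?exprn_ge0 // lerXn2r // nnegrE.
- exact: finite_measure_integrable_cst.
Qed.

Lemma all_moments_cst c : all_moments (fun=> c).
Proof. exact: (all_moments_bounded (C := `|c|)). Qed.

Lemma all_moments_indic A : measurable A -> all_moments (\1_A).
Proof.
move=> mA; apply: (all_moments_bounded (C := 1)) => [|w]; first exact: measurable_indic.
by rewrite indicE ger0_norm // lern1 leq_b1.
Qed.

Lemma all_moments_sum (I : Type) (r : seq I) (Q : pred I) (F : I -> T -> R) :
  (forall i, Q i -> all_moments (F i)) -> all_moments (fun w => \sum_(i <- r | Q i) F i w).
Proof.
move=> aF; elim: r => [|i r IHr].
  by under eq_fun do rewrite big_nil; exact: all_moments_cst.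
under eq_fun do rewrite big_cons.
by case: (boolP (Q i)) => // Qi; apply: all_moments_add => //; exact: aF.
Qed.

Lemma all_moments_prod (I : Type) (r : seq I) (Q : pred I) (F : I -> T -> R) :
  (forall i, Q i -> all_moments (F i)) -> all_moments (fun w => \prod_(i <- r | Q i) F i w).
Proof.
move=> aF; elim: r => [|i r IHr].
  by under eq_fun do rewrite big_nil; exact: all_moments_cst.
under eq_fun do rewrite big_cons.
by case: (boolP (Q i)) => // Qi; apply: all_moments_mul => //; exact: aF.
Qed.

(** The expectation as a real number, which obeys the laws of a ring; it is meaningful
for integrable [X] only. *)
Definition mean X : R := fine ('E_P[X])%E.

Lemma meanE X : all_moments X -> ('E_P[X] = (mean X)%:E)%E.
Proof.
move=> /all_moments_integrable iX.
by rewrite /mean unlock fineK //; apply: integrable_fin_num.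
Qed.

Lemma mean_cst c : mean (fun=> c) = c.
Proof. by rewrite /mean expectation_cst. Qed.

Lemma mean_add X Y : all_moments X -> all_moments Y ->
  mean (fun w => X w + Y w) = mean X + mean Y.
Proof.
move=> aX aY; apply: EFin_inj; rewrite EFinD -!meanE //; last exact: all_moments_add.
rewrite unlock; under eq_integral do rewrite EFinD.
by rewrite integralD //; apply: all_moments_integrable.
Qed.

Lemma mean_scale c X : all_moments X -> mean (fun w => c * X w) = c * mean X.
Proof.
move=> aX; apply: EFin_inj; rewrite EFinM -!meanE //; last first.
  by apply: all_moments_mul => //; exact: all_moments_cst.
rewrite unlock; under eq_integral do rewrite EFinM.
by rewrite integralZl //; apply: all_moments_integrable.
Qed.

Lemma mean_sum (I : Type) (r : seq I) (Q : pred I) (F : I -> T -> R) :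
  (forall i, Q i -> all_moments (F i)) ->
  mean (fun w => \sum_(i <- r | Q i) F i w) = \sum_(i <- r | Q i) mean (F i).
Proof.
move=> aF; elim: r => [|i r IHr].
  by under eq_fun do rewrite big_nil; rewrite big_nil mean_cst.
under eq_fun do rewrite big_cons; rewrite big_cons.
case: (boolP (Q i)) => // Qi; rewrite mean_add ?IHr //; first exact: aF.
exact: all_moments_sum.
Qed.

Lemma mean_indic A : measurable A -> mean \1_A = fine (P A).
Proof. by move=> mA; rewrite /mean expectation_indic. Qed.

End AllMoments.

(** * Independence *)

Section Independence.
Import HBNNSimple.
Context (d : measure_display) (T : measurableType d) (R : realType) (P : probability T R).
Implicit Types (X Y W : T -> R).

Lemma mean_dominated (f_ : nat -> T -> R) (f g : T -> R) :
  (forall n, measurable_fun setT (f_ n)) -> measurable_fun setT f ->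
  (forall w, f_ ^~ w @ \oo --> f w) ->
  P.-integrable setT (EFin \o g) -> (forall n w, `|f_ n w| <= g w) ->
  (fun n => mean P (f_ n)) @ \oo --> mean P f.
Proof.
move=> mf_ mf f_f ig f_g; rewrite /mean unlock.
have [] // := @dominated_convergence _ _ _ P setT measurableT
  (fun n => EFin \o f_ n) (EFin \o f) (EFin \o g).
- by move=> n; apply/measurable_EFinP.
- exact/measurable_EFinP.
- by apply: aeW => w _; apply: cvg_EFin; [apply: nearW | exact: f_f].
- by apply: aeW => w n _ /=; rewrite lee_fin.
- move=> intf _ lim; apply: fine_cvg; rewrite fineK //.
  exact: integrable_fin_num.
Qed.

(** The identity is linear in [Y] and holds for the indicators of events of [Y], hence
for simple functions of [Y]; these converge to [Y], dominated by [|Y|]. *)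
Lemma mean_mul_factor W Y (p : R) : all_moments P W -> all_moments P Y ->
  (forall B, measurable B ->
    mean P (fun w => W w * \1_(Y @^-1` B) w) = p * mean P (\1_(Y @^-1` B))) ->
  mean P (fun w => W w * Y w) = p * mean P Y.
Proof.
move=> aW aY WB.
have mY : measurable_fun setT Y by case: aY.
have mpreY B : measurable B -> measurable (Y @^-1` B).
  by move=> mB; rewrite -[_ @^-1` _]setTI; apply: mY.
have mopp : measurable_fun setT (fun x : R => - x) by exact: oppr_measurable.
have simple (h : {nnsfun R >-> R}) (u : R -> R) : measurable_fun setT u ->
    all_moments P (fun w => h (u (Y w))) /\
    mean P (fun w => W w * h (u (Y w))) = p * mean P (fun w => h (u (Y w))).
  move=> mu_; pose s : seq R := finmap.enum_fset (fset_set (range h)).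
  pose A (i : R) := Y @^-1` (u @^-1` (h @^-1` [set i])).
  have mB (i : R) : measurable (u @^-1` (h @^-1` [set i])).
    by rewrite -[_ @^-1` _]setTI; apply: mu_ => //; exact: measurable_sfunP.
  have mA i : measurable (A i) by exact: mpreY.
  have hE w : h (u (Y w)) = \sum_(i <- s) i * \1_(A i) w.
    by rewrite fimfunE fsbig_finite.
  have am i : all_moments P (fun w => i * \1_(A i) w).
    by apply: all_moments_mul; [exact: all_moments_cst | exact: all_moments_indic].
  under eq_fun do rewrite hE; split; first by apply: all_moments_sum.
  under eq_fun do rewrite hE mulr_sumr.
  rewrite [in RHS]mean_sum // mulr_sumr mean_sum => [|i _]; last exact: all_moments_mul.
  apply: eq_bigr => i _; under eq_fun do rewrite mulrCA.
  have aI : all_moments P \1_(A i) by exact: all_moments_indic.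
  rewrite (mean_scale i (all_moments_mul aW aI)) (mean_scale i aI).
  by rewrite WB // mulrCA.
have mmax : measurable_fun setT (fun x : R => (Num.max x 0)%:E).
  by apply/measurable_EFinP; apply: measurable_maxr.
pose h := nnsfun_approx measurableT mmax.
have max0 (x : R) : setT x -> (0 <= (Num.max x 0)%R%:E)%E.
  move=> _; rewrite lee_fin; by rewrite le_max lexx orbT.
have h_cvg x : h ^~ x @ \oo --> Num.max x 0.
  have := cvg_nnsfun_approx measurableT mmax max0 (I : setT x).
  by move/fine_cvg.
have h_le n x : h n x <= Num.max x 0.
  by rewrite -lee_fin nnsfun_approxE; apply: le_approx.
(* The simple functions approximating the positive part, at [y] and at [- y]. *)
pose k n (y : R) := h n y - h n (- y).
have k_cvg y : k ^~ y @ \oo --> y.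
  have yE : y = Num.max y 0 - Num.max (- y) 0.
    rewrite !maxEle oppr_le0; case: (leP y 0) => y0; case: (leP 0 y) => y0'; try lra.
  by rewrite [X in _ --> X]yE; apply: cvgB; exact: h_cvg.
have k_le n y : `|k n y| <= `|y|.
  have := h_le n y; have := h_le n (- y); rewrite /k.
  have : 0 <= h n y by []. 
  have : 0 <= h n (- y) by [].
  rewrite !maxEle oppr_le0; case: (leP y 0) => y0; case: (leP 0 y) => y0' h1 h2 h3 h4;
    rewrite ler_norml; try rewrite (ger0_norm y0'); try rewrite (ler0_norm y0);
    apply/andP; split; lra.
have mid : measurable_fun setT (fun x : R => x) by exact: measurable_id.
have mh n (u : R -> R) : measurable_fun setT u -> measurable_fun setT (fun w => h n (u (Y w))).
  by move=> mu_; have [] := (simple (h n) u mu_).1.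
have mk n : measurable_fun setT (fun w => k n (Y w)).
  by apply: measurable_funB; [exact: (mh n (fun x => x)) | exact: (mh n (fun x => - x))].
have aWY := all_moments_mul aW aY.
have lim1 : (fun n => mean P (fun w => W w * k n (Y w))) @ \oo --> mean P (fun w => W w * Y w).
  apply: (mean_dominated (g := fun w => `|W w * Y w|)).
  - by move=> n; apply: measurable_funM; [case: aW | exact: mk].
  - by case: aWY.
  - by move=> w; apply: cvgM; [exact: cvg_cst | exact: k_cvg].
  - exact: (integrable_abse (all_moments_integrable aWY)).
  - by move=> n w; rewrite !normrM ler_wpM2l.
have lim2 : (fun n => mean P (fun w => k n (Y w))) @ \oo --> mean P Y.
  apply: (mean_dominated (g := fun w => `|Y w|)) => //.
  exact: (integrable_abse (all_moments_integrable aY)).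
have E n : mean P (fun w => W w * k n (Y w)) = p * mean P (fun w => k n (Y w)).
  have [a1 e1] := simple (h n) _ mid; have [a2 e2] := simple (h n) _ mopp.
  have subE (X Z : T -> R) : all_moments P X -> all_moments P Z ->
      mean P (fun w => X w - Z w) = mean P X - mean P Z.
    move=> aX aZ; rewrite -mulN1r -mean_scale // -mean_add //.
      by congr (mean P _); apply/funext => w; rewrite mulN1r.
    by apply: all_moments_mul => //; exact: all_moments_cst.
  rewrite /k subE // mulrBr -e1 -e2 -subE; try exact: all_moments_mul.
  by congr (mean P _); apply/funext => w; rewrite mulrBr.
rewrite (_ : (fun n => _) = fun n => p * mean P (fun w => k n (Y w))) in lim1; last first.
  by apply/funext => n; exact: E.
apply: (cvg_unique _ lim1) => //.
by apply: cvgM; [exact: cvg_cst | exact: lim2].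
Qed.

(** The factors that are not indicators are replaced one at a time by indicators
of events of their own sigma-algebra, until only the product rule for events is
left. *)
Lemma mean_prod_independent (I : finType) (F : I -> set (set T)) (Y : I -> T -> R) :
  independent_family P F -> (forall i, all_moments P (Y i)) ->
  (forall i B, measurable B -> F i (Y i @^-1` B)) ->
  mean P (fun w => \prod_i Y i w) = \prod_i mean P (Y i).
Proof.
move=> indF.
suff key (J : {set I}) (Z : I -> T -> R) : (forall i, all_moments P (Z i)) ->
    (forall i, i \in J -> forall B, measurable B -> F i (Z i @^-1` B)) ->
    (forall i, i \notin J -> exists A, [/\ measurable A, F i A & Z i = \1_A]) ->
    mean P (fun w => \prod_i Z i w) = \prod_i mean P (Z i).
  move=> aY mY; apply: (key [set: I]%SET) => // i; first by move=> _; exact: mY.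
  by rewrite inE.
have [m] := ubnP #|J|; elim: m J Z => // m IHm J Z ltJ aZ mZ iZ.
have [J0|[j jJ]] := set_0Vmem J.
  have /choice[A AP] i : exists A, [/\ measurable A, F i A & Z i = \1_A].
    by apply: iZ; rewrite J0 inE.
  have ZE : (fun w => \prod_i Z i w) = \1_(\bigcap_(i in [set i | i \in [set: I]%SET]) A i).
    apply/funext => w; rewrite indicE.
    case: (boolP (w \in _)) => [|wN].
      rewrite inE => wA; rewrite big1 // => i _; have [_ _ ->] := AP i.
      by rewrite indicE mem_set //; apply: wA; rewrite /= inE.
    have [i /negP wi] : exists i, ~ (w \in A i).
      apply/not_existsP => wA; move/negP: wN; apply; apply/mem_set => i _.
      by apply/set_mem; have /contrapT := wA i.
    apply/eqP/prodf_eq0; exists i => //; have [_ _ ->] := AP i.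
    by rewrite indicE (negPf wi).
  rewrite ZE mean_indic; last first.
    by apply: fin_bigcap_measurable => // i _; have [] := AP i.
  rewrite (indF [set: I]%SET) => [|i _]; last by have [] := AP i.
  rewrite big_mkcond /=.
  have PE i : P (A i) = (mean P (Z i))%:E.
    have [mA _ ->] := AP i; rewrite mean_indic // fineK //.
    exact: fin_num_measure.
  under eq_bigr do rewrite inE PE.
  by rewrite prodEFin.
pose W w := \prod_(i | i != j) Z i w.
have aW : all_moments P W by apply: all_moments_prod.
rewrite [RHS](bigD1 j) //= mulrC.
under eq_fun do rewrite (bigD1 j) //= mulrC.
apply: (mean_mul_factor aW (aZ j)) => B mB.
have mA : measurable (Z j @^-1` B).
  by rewrite -[_ @^-1` _]setTI; have [mZj _] := aZ j; apply: mZj.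
pose Z' i := if i == j then \1_(Z j @^-1` B) else Z i.
have Z'j : Z' j = \1_(Z j @^-1` B) by rewrite /Z' eqxx.
have Z'i i : i != j -> Z' i = Z i by rewrite /Z' => /negPf->.
have := IHm (J :\ j)%SET Z'.
have -> : (fun w => \prod_i Z' i w) = (fun w => W w * \1_(Z j @^-1` B) w).
  apply/funext => w; rewrite (bigD1 j) //= Z'j mulrC; congr (_ * _).
  by apply: eq_bigr => i /Z'i->.
rewrite (bigD1 j) //= Z'j [X in _ = X]mulrC.
rewrite [\prod_(i | i != j) mean P (Z' i)](eq_bigr (fun i => mean P (Z i))) => [|i /Z'i->//].
apply.
- by move: ltJ; rewrite (cardsD1 j) jJ.
- move=> i; rewrite /Z'; case: eqP => // _; exact: all_moments_indic.
- by move=> i; rewrite !inE => /andP[/Z'i-> iJ] B' mB'; exact: mZ.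
- move=> i; have [->|ij] := eqVneq i j.
    by move=> _; exists (Z j @^-1` B); split => //; exact: mZ.
  by rewrite !inE ij /= => iJ; rewrite Z'i //; exact: iZ.
Qed.
End Independence.

(** * Wishart matrices *)

Section GaussianFamily.
Context (d : measure_display) (T : measurableType d) (R : realType) (P : probability T R).
Notation nu := (@normal_prob R 0 1).

Lemma std_normal_moments (g : {RV P >-> R}) :
  (forall B : set R, measurable B -> distribution P g B = nu B) ->
  all_moments P g /\ forall k, mean P (fun w => g w ^+ k) = (num_matchings k)%:R.
Proof.
move=> gB.
(* [normal_prob] is a measure on [measurableTypeR R], which has the same measurable
   sets as [R] but another display. *)
pose g' : T -> measurableTypeR R := g.
have mg' : measurable_fun setT g' by exact: (@measurable_funPT _ _ _ _ g).
have dE (f : measurableTypeR R -> \bar R) :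
    (\int[pushforward P g']_y f y = \int[nu]_y f y)%E.
  by apply: eq_measure_integral => // A mA _; exact: gB.
have mk k : measurable_fun setT (EFin \o (fun x : measurableTypeR R => (x : R) ^+ k)).
  by apply/measurable_EFinP; exact: exprn_measurable.
have intk k : P.-integrable setT (EFin \o (fun w => g w ^+ k)).
  apply/integrableP; split.
    by apply/measurable_EFinP; apply: measurable_funX.
  have [/integrableP[_ fin_k] _] := @normal_moment R k.
  move: fin_k; rewrite -dE ge0_integral_pushforward //.
  exact: measurableT_comp.
split; first by split.
move=> k; rewrite /mean unlock.
rewrite -[RHS]/(fine (num_matchings k)%:R%:E); have [_ <-] := @normal_moment R k.
rewrite -dE integral_pushforward //.
  by apply/measurable_EFinP; exact: exprn_measurable.
by rewrite preimage_setT; exact: (intk k).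
Qed.

(** Wick's formula; in this form the expectation is the product of the numbers of
perfect matchings of the sets of factors that are equal to one another. *)
Lemma mean_prod_iid_normal (E D : finType) (g : E -> {RV P >-> R}) (Q : pred D) (v : D -> E) :
  iid_std_normal g ->
  mean P (fun w => \prod_(x | Q x) g (v x) w)
    = \prod_e (num_matchings #|[set x | Q x && (v x == e)]%SET|)%:R.
Proof.
move=> [indg gB].
have moments_ e := std_normal_moments (gB e).
have -> : (fun w => \prod_(x | Q x) g (v x) w) =
    (fun w => \prod_e g e w ^+ #|[set x | Q x && (v x == e)]%SET|).
  apply/funext => w; rewrite (partition_big v predT) //=; apply: eq_bigr => e _.
  rewrite (eq_bigr (fun=> g e w)) => [|x /andP[_ /eqP->]//].
  by rewrite prodr_const; congr (_ ^+ _); apply: eq_card => x; rewrite !inE.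
rewrite (mean_prod_independent indg).
- by apply: eq_bigr => e _; have [_ ->] := moments_ e.
- move=> e; have [[mg ig] _] := moments_ e; split; first exact: measurable_funX.
  move=> k; have := ig (#|[set x | Q x && (v x == e)]%SET| * k)%N.
  by congr (_.-integrable _ _); apply/funext => w /=; rewrite exprM.
- move=> e B mB; exists ((fun x : R => x ^+ #|[set x | Q x && (v x == e)]%SET|) @^-1` B).
    by rewrite -[_ @^-1` _]setTI; apply: exprn_measurable.
  by rewrite setTI.
Qed.

End GaussianFamily.

Section WishartMean.
Context (d : measure_display) (T : measurableType d) (R : realType) (P : probability T R).
Variables (N K s m : nat) (X : 'I_s -> T -> 'M[R]_N) (l : 'I_m.+1 -> 'I_s).
Local Notation n := m.+1.
Hypotheses (K_gt0 : (0 < K)%N) (X_wishart : forall i, real_wishart P K (X i)).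
Hypothesis X_indep : independent_family P (fun i => sigma_rmx (X i)).
Implicit Types (a : {ffun 'I_n -> 'I_N}) (f : {ffun 'I_n -> 'I_K}).

Let j0 : 'I_K := Ordinal K_gt0.

Definition color_factor a i w := \prod_(k | l k == i) X i w (a k) (a (ordS k)).

Definition color_count a i f (e : 'I_N * 'I_K) :=
  #|[set x : pm_ord n | (l x.1 == i) && ((row_index a x, f x.1) == e)]%SET|.

Lemma prod_signed (Q : pred 'I_n) (F : pm_ord n -> R) :
  \prod_(x : pm_ord n | Q x.1) F x = \prod_(k | Q k) (F (k, false) * F (k, true)).
Proof.
transitivity (\prod_(k | Q k) \prod_(b : bool) F (k, b)).
  by rewrite pair_big /=; apply: eq_big => [[k b]|[k b]] /=; rewrite ?andbT.
by apply: eq_bigr => k _; rewrite big_bool mulrC.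
Qed.

(** The Gaussian entries are known to be independent within each matrix only, and so
the colours are treated one at a time; independence across colours is available
for the matrices themselves. *)
Lemma color_factor_mean a i : all_moments P (color_factor a i) /\
  mean P (color_factor a i) = (\prod_(k | l k == i) N%:R^-1) *
    \sum_(f in pffun_on j0 [pred k | l k == i] predT)
      \prod_e (num_matchings (color_count a i f e))%:R.
Proof.
have [g [iid_g XE]] := X_wishart i.
have [indg gB] := iid_g.
have am e : all_moments P (g e) by have [] := std_normal_moments (gB e).
have YE : color_factor a i = fun w => (\prod_(k | l k == i) N%:R^-1) *
    \sum_(f in pffun_on j0 [pred k | l k == i] predT)
      \prod_(x : pm_ord n | l x.1 == i) g (row_index a x, f x.1) w.
  apply/funext => w; rewrite /color_factor.
  transitivity (\prod_(k | l k == i) (N%:R^-1 *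
      \sum_(j : 'I_K) g (a k, j) w * g (a (ordS k), j) w)).
    apply: eq_bigr => k _; rewrite XE !mxE; congr (_ * _).
    by apply: eq_bigr => j _; rewrite !mxE.
  rewrite big_split /=; congr (_ * _).
  rewrite (big_distr_big j0) /=; apply: eq_bigr => f _.
  rewrite (prod_signed (fun k => l k == i) (fun x => g (row_index a x, f x.1) w)).
  by apply: eq_bigr => k _; rewrite /row_index.
have amp f : all_moments P (fun w => \prod_(x : pm_ord n | l x.1 == i) g (row_index a x, f x.1) w).
  exact: all_moments_prod.
have ams : all_moments P (fun w => \sum_(f in pffun_on j0 [pred k | l k == i] predT)
      \prod_(x : pm_ord n | l x.1 == i) g (row_index a x, f x.1) w).
  exact: all_moments_sum.
rewrite YE; split; first by apply: all_moments_mul => //; exact: all_moments_cst.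
rewrite mean_scale // mean_sum //; congr (_ * _); apply: eq_bigr => f _.
exact: (mean_prod_iid_normal (fun x : pm_ord n => l x.1 == i)
  (fun x => (row_index a x, f x.1)) iid_g).
Qed.

(** Products of entries are measurable for the sigma-algebra they generate, which is
the measurable structure given to [T] here. *)
Lemma color_factor_measurable a i (B : set R) : measurable B ->
  sigma_rmx (X i) (color_factor a i @^-1` B).
Proof.
move=> mB; pose G := [set A | exists x y, sigma_rv (fun w => X i w x y) A].
have mX x y : measurable_fun setT (fun w : g_sigma_algebraType G => X i w x y).
  by move=> _ C mC; apply: sub_sigma_algebra; exists x, y; exists C.
have mY : measurable_fun setT (color_factor a i : g_sigma_algebraType G -> R).
  rewrite /color_factor; under eq_fun do rewrite -big_filter.
  exact: measurable_prod.
by rewrite -[_ @^-1` _]setTI; apply: mY.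
Qed.

(** Independence separates the colours, [sum_prod_fibers] joins the column indices of
all colours again, and [wick_count] sums over all indices. *)
Lemma mean_trace :
  ('E_P[fun w => ntr (\prod_(k < n) X (l k) w)] =
  (\sum_(t : {perm pm_ord n} |
       is_pairing (delta n * t)%g && refines (porbits t) (tilde (ker_part l)))
     N%:R ^- n.+1 * N%:R ^+ #|porbits (gamma_tilde n * t^-1)%g|./2
       * K%:R ^+ #|porbits t|./2)%R%:E)%E.
Proof.
have YE : (fun w => ntr (\prod_(k < n) X (l k) w)) =
    (fun w => N%:R^-1 * \sum_a \prod_i color_factor a i w).
  apply/funext => w; rewrite /ntr; congr (_ * _).
  rewrite trace_prod; apply: eq_bigr => a _.
  rewrite (partition_big l predT) //=; apply: eq_bigr => i _.
  by apply: eq_bigr => k /eqP->.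
have am a i : all_moments P (color_factor a i) by have [] := color_factor_mean a i.
have amp a : all_moments P (fun w => \prod_i color_factor a i w).
  exact: all_moments_prod.
have ams : all_moments P (fun w => \sum_a \prod_i color_factor a i w).
  exact: all_moments_sum.
rewrite YE meanE; last by apply: all_moments_mul => //; exact: all_moments_cst.
rewrite mean_scale // mean_sum //; congr EFin.
transitivity (N%:R ^- n.+1 * (\sum_(t : {perm pm_ord n} |
    is_pairing (delta n * t)%g && refines (porbits t) (tilde (ker_part l)))
     N ^ #|porbits (gamma_tilde n * t^-1)%g|./2 * K ^ #|porbits t|./2)%N%:R : R); last first.
  rewrite natr_sum mulr_sumr; apply: eq_bigr => t _.
  by rewrite natrM !natrX mulrA.
rewrite -wick_count exprS invfM -mulrA; congr (_ * _).
rewrite natr_sum mulr_sumr; apply: eq_bigr => a _.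
rewrite (mean_prod_independent X_indep) //; last exact: color_factor_measurable.
under eq_bigr do rewrite (color_factor_mean a _).2.
rewrite big_split /=; congr (_ * _).
  transitivity (\prod_(k < n) N%:R^-1 : R); last by rewrite prodr_const card_ord exprVn.
  by rewrite [RHS](partition_big l predT).
rewrite sum_prod_fibers; last first.
  move=> i f f' ff'; apply: eq_bigr => e _; congr (num_matchings _)%:R.
  rewrite /color_count; apply: eq_card => x; rewrite !inE.
  by case: eqP => // lx; rewrite ff'.
rewrite natr_sum; apply: eq_bigr => f _; rewrite natr_prod pair_big /=.
apply: eq_bigr => -[i e] _ /=; congr (num_matchings _)%:R; exact: eq_card.
Qed.

End WishartMean.

(** * The limit *)

Section Limits.
Variables (R : realType) (c c' : R) (M : nat -> nat).
Hypothesis M_lim : (fun N => (M N)%:R - c * N%:R) @ \oo --> c'.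

Let q N : R := (M N)%:R / N%:R.

Lemma cvg_sum_fin (I : finType) (Q : pred I) (F : I -> nat -> R) (a : I -> R) :
  (forall i, Q i -> F i @ \oo --> a i) ->
  (fun N => \sum_(i | Q i) F i N) @ \oo --> \sum_(i | Q i) a i.
Proof. by move=> Fa; apply: cvg_big => //; exact: add_continuous. Qed.

Lemma near_N_gt0 : \forall N \near \oo, (0 < N)%N.
Proof. exact: nbhs_infty_gt. Qed.

Lemma cvg_invn : (fun N : nat => N%:R^-1 : R) @ \oo --> 0.
Proof.
apply/gtr0_cvgV0; last exact: cvgr_idn.
by near=> N; rewrite ltr0n; near: N; exact: near_N_gt0.
Unshelve. all: by end_near. Qed.

Lemma cvg_ratio_rate : (fun N => N%:R * (q N - c)) @ \oo --> c'.
Proof.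
apply: cvg_trans M_lim; apply: near_eq_cvg; near=> N.
have N0 : (0 < N)%N by near: N; exact: near_N_gt0.
by rewrite /q; field; rewrite pnatr_eq0 -lt0n.
Unshelve. all: by end_near. Qed.

Lemma cvg_ratio : q @ \oo --> c.
Proof.
have : (fun N => N%:R^-1 * (N%:R * (q N - c)) + c) @ \oo --> 0 * c' + c.
  by apply: cvgD; [apply: cvgM; [exact: cvg_invn | exact: cvg_ratio_rate] | exact: cvg_cst].
rewrite mul0r add0r; apply: cvg_trans; apply: near_eq_cvg; near=> N.
have N0 : (0 < N)%N by near: N; exact: near_N_gt0.
by field; rewrite pnatr_eq0 -lt0n.
Unshelve. all: by end_near. Qed.

Lemma cvg_ratio_exp p : (fun N => q N ^+ p) @ \oo --> c ^+ p.
Proof.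
elim: p => [|p IHp]; first by rewrite expr0; apply: cvg_cst.
under eq_fun do rewrite exprS; rewrite exprS.
by apply: cvgM => //; exact: cvg_ratio.
Qed.

(** The derivative of a power, by induction on the exponent. *)
Lemma cvg_ratio_exp_rate p :
  (fun N => N%:R * (q N ^+ p - c ^+ p)) @ \oo --> c' * p%:R * c ^+ p.-1.
Proof.
elim: p => [|p IHp].
  rewrite mulr0 mul0r; under eq_fun do rewrite !expr0 subrr mulr0.
  exact: cvg_cst.
have -> : (fun N => N%:R * (q N ^+ p.+1 - c ^+ p.+1)) =
    (fun N => q N * (N%:R * (q N ^+ p - c ^+ p)) + N%:R * (q N - c) * c ^+ p).
  by apply/funext => N; rewrite !exprS; ring.
have -> : c' * p.+1%:R * c ^+ p.+1.-1 = c * (c' * p%:R * c ^+ p.-1) + c' * c ^+ p.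
  by case: p {IHp} => [|p] /=; rewrite ?exprS -!natr1; ring.
apply: cvgD; first by apply: cvgM => //; exact: cvg_ratio.
by apply: cvgM; [exact: cvg_ratio_rate | exact: cvg_cst].
Qed.

(** For [N > 0] the sequence equals [q N ^+ p * N ^- e]. *)
Lemma cvg_scaled_term n k p e : (k + p + e.+1 = n.+1)%N ->
  (fun N => N%:R * (N%:R ^- n.+1 * N%:R ^+ k * (M N)%:R ^+ p)) @ \oo -->
  (e == 0)%:R * c ^+ p.
Proof.
move=> kpe; have : (fun N : nat => (N%:R^-1) ^+ e * q N ^+ p) @ \oo --> (e == 0)%:R * c ^+ p.
  apply: cvgM; last exact: cvg_ratio_exp.
  case: e {kpe} => [|e]; first by under eq_fun do rewrite expr0; exact: cvg_cst.
  elim: e => [|e IHe]; first by under eq_fun do rewrite expr1; exact: cvg_invn.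
  under eq_fun do rewrite exprS.
  have -> : (e.+2 == 0)%:R = 0 * (e.+1 == 0)%:R :> R by rewrite mul0r.
  by apply: cvgM => //; exact: cvg_invn.
apply: cvg_trans; apply: near_eq_cvg; near=> N.
have N0 : (0 < N)%N by near: N; exact: near_N_gt0.
have Nn0 : N%:R != 0 :> R by rewrite pnatr_eq0 -lt0n.
rewrite -kpe /q !exprD exprS expr_div_n exprVn.
by field; rewrite !expf_neq0 ?Nn0.
Unshelve. all: by end_near. Qed.

Lemma cvg_leading_term n k p : (p + k = n.+1)%N ->
  (fun N => N%:R * (N%:R ^- n.+1 * N%:R ^+ k * (M N)%:R ^+ p - c ^+ p)) @ \oo -->
  c' * p%:R * c ^+ p.-1.
Proof.
move=> pk; have := @cvg_ratio_exp_rate p.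
apply: cvg_trans; apply: near_eq_cvg; near=> N.
have N0 : (0 < N)%N by near: N; exact: near_N_gt0.
have Nn0 : N%:R != 0 :> R by rewrite pnatr_eq0 -lt0n.
rewrite -pk /q !exprD expr_div_n; congr (_ * (_ - _)).
by field; rewrite !expf_neq0.
Unshelve. all: by end_near. Qed.

End Limits.

(** Both cycle counts are even, so that nothing is lost by halving them. *)
Lemma half_cycles (m : nat) (t : {perm pm_ord m.+1}) :
  is_pairing (delta m.+1 * t)%g ->
  [transitive <<[set t; gamma_tilde m.+1]%SET>>, on [set: pm_ord m.+1]%SET | 'P] ->
  (#|porbits (gamma_tilde m.+1 * t^-1)%g|./2 + #|porbits t|./2 <= m.+1)%N /\
  (t \in SNC_delta m.+1) =
    (m.+1 - (#|porbits (gamma_tilde m.+1 * t^-1)%g|./2 + #|porbits t|./2) == 0)%N.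
Proof.
move=> pt tr; have := tr; rewrite transitive_crossing => /crossing_genus.
rewrite inE tr pt andbT /=.
have [] : ~~ odd #|porbits t| /\ ~~ odd #|porbits (gamma_tilde m.+1 * t^-1)%g|.
  by apply: even_cycles; rewrite pairing_card_porbits.
move: #|porbits t| #|porbits (gamma_tilde m.+1 * t^-1)%g| => x y.
by rewrite -!dvdn2 => ox oy; lia.
Qed.

(** The defect of a permutation that is not planar is even, hence at least two. *)
Lemma krew_defect (m : nat) (a : {perm 'I_m.+1}) : ~~ planar a ->
  exists e, (#|porbits (krew a)| + #|porbits a| + e.+2 = m.+2)%N.
Proof.
rewrite /planar => np; have := krew_parity a; have := planar_le a.
move: #|porbits a| #|porbits (krew a)| np => x y np le_xy odd_xy.
by exists (m - (y + x))%N; lia.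
Qed.

Theorem theorem21 (R : realType) (c c' : R) (M : nat -> nat) (s n : nat)
    (l : 'I_n -> 'I_s)
    (d : nat -> measure_display) (T : forall N, measurableType (d N))
    (P : forall N, probability (T N) R)
    (X : forall N, 'I_s -> T N -> 'M[R]_N)
    (c_gt0 : 0 < c) (M_gt0 : forall N, (0 < M N)%N)
    (M_lim : (fun N => (M N)%:R - c * N%:R) @ \oo --> c')
    (X_wishart : forall N i, real_wishart (P N) (M N) (X N i))
    (X_indep : forall N, independent_family (P N) (fun i => sigma_rmx (X N i)))
    (n_gt0 : (0 < n)%N) :
  (fun N => N%:R%:E *
     ('E_(P N)[fun w => ntr (\prod_(k < n) X N (l k) w)]
      - (\sum_(p in NC n | refines p (ker_part l)) c ^+ #|p|)%R%:E))%E @ \oo -->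
  (\sum_(p in NC n | refines p (ker_part l)) c' * #|p|%:R * c ^+ #|p|.-1
   + \sum_(t in SNC_delta n | refines (porbits t) (tilde (ker_part l)))
       c `^ (#|porbits t|%:R / 2))%:E.
Proof.
case: n n_gt0 l => // m _ l.
pose W N p k : R := N%:R ^- m.+2 * N%:R ^+ k./2 * (M N)%:R ^+ p./2.
pose tr_pairing (t : {perm pm_ord m.+1}) := [&& is_pairing (delta m.+1 * t)%g,
  refines (porbits t) (tilde (ker_part l)) &
  [transitive <<[set t; gamma_tilde m.+1]%SET>>, on [set: pm_ord m.+1]%SET | 'P]].
pose U N (t : {perm pm_ord m.+1}) :=
  N%:R * W N #|porbits t| #|porbits (gamma_tilde m.+1 * t^-1)%g|.
pose V N (a : {perm 'I_m.+1}) : R :=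
  N%:R ^- m.+2 * N%:R ^+ #|porbits (krew a)| * (M N)%:R ^+ #|porbits a|.
have EN N : (N%:R%:E * ('E_(P N)[fun w => ntr (\prod_(k < m.+1) X N (l k) w)]
      - (\sum_(p in NC m.+1 | refines p (ker_part l)) c ^+ #|p|)%R%:E))%E =
  (\sum_(a | planar a && refines (porbits a) (ker_part l)) N%:R * (V N a - c ^+ #|porbits a|)
   + \sum_(a | ~~ planar a && refines (porbits a) (ker_part l)) N%:R * V N a
   + \sum_(t | tr_pairing t) U N t)%:E.
  rewrite (mean_trace l (M_gt0 N) (X_wishart N) (X_indep N)) -EFinB -EFinM; congr EFin.
  rewrite (sum_pairings l (W N)) sum_NC (bigID (@planar m)) /=.
  rewrite (eq_bigl (fun a => planar a && refines (porbits a) (ker_part l)))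
    => [|a]; last exact: andbC.
  rewrite [\sum_(a | _ && ~~ _) _](eq_bigl
    (fun a => ~~ planar a && refines (porbits a) (ker_part l))) => [|a]; last exact: andbC.
  under eq_bigr do rewrite /W !doubleK.
  under [\sum_(a | ~~ _ && _) _]eq_bigr do rewrite /W !doubleK.
  rewrite [\sum_(a | planar a && _) N%:R * _](_ : _ = N%:R *
    (\sum_(a | planar a && refines (porbits a) (ker_part l)) V N a
     - \sum_(a | planar a && refines (porbits a) (ker_part l)) c ^+ #|porbits a|)); last first.
    by rewrite -sumrB mulr_sumr.
  rewrite -mulr_sumr /U -mulr_sumr -!mulrDr /V; congr (_ * _); ring.
under eq_fun do rewrite EN.
apply: cvg_EFin; first by apply: nearW.
(* The planar permutations give the first sum of the limit, the other permutations of
   the indices nothing, and the connecting permutations the second sum. *)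
rewrite -[X in _ --> (X + _)%R]addr0.
apply: cvgD; first apply: cvgD.
- rewrite sum_NC; apply: cvg_sum_fin => a /andP[/eqP pa _].
  exact: cvg_leading_term.
- rewrite [X in _ --> X](_ : 0 = \sum_(a : {perm 'I_m.+1} |
    ~~ planar a && refines (porbits a) (ker_part l)) 0); last by rewrite big1.
  apply: cvg_sum_fin => a /andP[/krew_defect[e ae] _].
  rewrite -[X in _ --> X](mul0r (c ^+ #|porbits a|)).
  exact: (cvg_scaled_term M_lim ae).
(* Outside [SNC_delta] a connecting term is of order at most [N ^- 2]. *)
- rewrite [X in _ --> X](_ : _ = \sum_(t | tr_pairing t)
    (t \in SNC_delta m.+1)%:R * c ^+ #|porbits t|./2); last first.
    rewrite [RHS](bigID (fun t => t \in SNC_delta m.+1)) /=.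
    rewrite [X in _ = _ + X]big1 ?addr0 => [|t /andP[_ /negPf->]]; last by rewrite mul0r.
    apply: eq_big => [t|t /andP[tS _]].
      rewrite /tr_pairing inE; case: (is_pairing _); case: (refines _ _); rewrite ?andbT ?andbF //=.
      by case: [transitive _, on _ | _].
    rewrite tS mul1r -powR_mulrn ?ltW //; congr (_ `^ _).
    move: tS; rewrite inE => /and3P[_ _].
    rewrite /is_pairing -pairing_card_porbits => /even_cycles[/even_halfK pt _].
    rewrite -[in LHS]pt -muln2 natrM mulfK //.
  apply: cvg_sum_fin => t /and3P[pt _ tr].
  have [le_m ->] := half_cycles pt tr.
  by apply: (cvg_scaled_term M_lim); rewrite addnS subnKC.
Qed.
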